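(* Assume that two Euclidean boxes are isospectral with respect to the Dirichlet boundary condition (taken on both boxes) or with respect to the Neumann boundary condition (taken on both boxes). Then the two boxes are isometric.
   Context: A Euclidean box is a bounded domain in $\mathbb{R}^n$ that is the Cartesian product of $n$ bounded intervals (the dimension $n\ge 1$ is not assumed a priori to be the same for the two boxes). The Laplace operator is $\Delta=-\sum_{i=1}^n\partial^2/\partial x_i^2$. The Dirichlet condition requires eigenfunctions to vanish on the boundary; the Neumann condition requires eigenfunctions to have vanishing normal derivative on the smooth components of the boundary. Two boxes are isospectral with respect to a boundary condition if their Laplace eigenvalues with that boundary condition, counted with multiplicity, coincide. *)

(* Defs.v *)
From mathcomp Require Import all_boot all_order all_algebra.
From mathcomp Require Import all_classical all_reals all_analysis.
Set Implicit Arguments.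
Unset Strict Implicit.
Unset Printing Implicit Defensive.
Import Order.TTheory GRing.Theory Num.Theory.
Import numFieldNormedType.Exports.
Local Open Scope classical_set_scope.
Local Open Scope ring_scope.

(* The library norm on 'rV[R]_n is the sup norm, hence this definition. *)
Definition euclidean_dist (R : realType) (n : nat) (x y : 'rV[R]_n) : R :=
  Num.sqrt (\sum_(i < n) (x 0 i - y 0 i) ^+ 2).

Record euclidean_box (R : realType) (n : nat) := EuclideanBox {
  box_lo : 'rV[R]_n;
  box_hi : 'rV[R]_n;
  box_lo_lt_hi : forall i : 'I_n, box_lo 0 i < box_hi 0 i
}.

Definition box_set (R : realType) (n : nat) (B : euclidean_box R n) :
    set 'rV[R]_n :=
  [set x | forall i : 'I_n, x 0 i \in `]box_lo B 0 i, box_hi B 0 i[].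

Definition box_boundary (R : realType) (n : nat) (B : euclidean_box R n) :
    set 'rV[R]_n :=
  closure (box_set B) `\` box_set B.

(* Two boxes are isometric as metric spaces, each with the Euclidean distance
   of its own ambient space; the values of f off the first box are junk. *)
Definition isometric (R : realType) (n1 n2 : nat)
    (B1 : euclidean_box R n1) (B2 : euclidean_box R n2) : Prop :=
  exists f : 'rV[R]_n1 -> 'rV[R]_n2,
    (forall x y, box_set B1 x -> box_set B1 y ->
       euclidean_dist (f x) (f y) = euclidean_dist x y) /\
    f @` box_set B1 = box_set B2.

Definition basis_vec (R : realType) (n : nat) (i : 'I_n) : 'rV[R]_n :=
  delta_mx 0 i.

Definition partial_deriv (R : realType) (n : nat) (i : 'I_n)
    (u : 'rV[R]_n -> R) : 'rV[R]_n -> R :=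
  'D_(basis_vec R i) u.

(* The sign convention makes this a nonnegative operator. *)
Definition laplace (R : realType) (n : nat) (u : 'rV[R]_n -> R)
    (x : 'rV[R]_n) : R :=
  - \sum_(i < n) partial_deriv i (partial_deriv i u) x.

Definition extends_continuously (R : realType) (n : nat)
    (A : set 'rV[R]_n) (f : 'rV[R]_n -> R) : Prop :=
  exists g : 'rV[R]_n -> R,
    {within closure A, continuous g} /\ (forall x, A x -> g x = f x).

(* u is in C^2 of the closure of the open set A: it is C^2 on A, and u and its
   partial derivatives up to order 2 extend continuously to the closure. The
   values of u on the boundary of A are those of the extension; its values off
   the closure are junk. *)
Record C2_closure (R : realType) (n : nat) (A : set 'rV[R]_n)
    (u : 'rV[R]_n -> R) : Prop := {
  C2_continuous : {within closure A, continuous u};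
  C2_derivable : forall (i : 'I_n) x, A x -> derivable u x (basis_vec R i);
  C2_partial : forall i : 'I_n, extends_continuously A (partial_deriv i u);
  C2_derivable2 : forall (i j : 'I_n) x,
    A x -> derivable (partial_deriv i u) x (basis_vec R j);
  C2_partial2 : forall i j : 'I_n,
    extends_continuously A (partial_deriv j (partial_deriv i u))
}.

(* x lies in the relative interior of a facet of the box (these relative
   interiors are the smooth components of the boundary), and v is the outward
   unit normal of that facet. *)
Definition outward_normal (R : realType) (n : nat) (B : euclidean_box R n)
    (x v : 'rV[R]_n) : Prop :=
  exists i : 'I_n,
    ((x 0 i = box_hi B 0 i /\ v = basis_vec R i) \/
     (x 0 i = box_lo B 0 i /\ v = - basis_vec R i)) /\
    (forall j : 'I_n, j != i -> x 0 j \in `]box_lo B 0 j, box_hi B 0 j[).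

Inductive boundary_condition := Dirichlet | Neumann.

(* The normal derivative at a boundary point is the limit from inside the box
   of the derivative in the normal direction. *)
Definition satisfies_bc (R : realType) (n : nat) (bc : boundary_condition)
    (B : euclidean_box R n) (u : 'rV[R]_n -> R) : Prop :=
  match bc with
  | Dirichlet => forall x, box_boundary B x -> u x = 0
  | Neumann => forall x v, outward_normal B x v ->
      'D_v u y @[y --> within (box_set B) (nbhs x)] --> (0 : R)
  end.

(* The eigenfunctions with eigenvalue l, together with 0. *)
Definition eigenspace (R : realType) (n : nat) (bc : boundary_condition)
    (B : euclidean_box R n) (l : R) : set ('rV[R]_n -> R) :=
  [set u | [/\ C2_closure (box_set B) u,
               (forall x, box_set B x -> laplace u x = l * u x) &
               satisfies_bc bc B u]].

(* The eigenspace has dimension k: it has a basis of k elements. Functions are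
   identified when they agree on the box. With k = 0 this says that l is not
   an eigenvalue. *)
Definition has_multiplicity (R : realType) (n : nat) (bc : boundary_condition)
    (B : euclidean_box R n) (l : R) (k : nat) : Prop :=
  exists b : 'I_k -> 'rV[R]_n -> R,
    [/\ forall i, eigenspace bc B l (b i),
        (forall c : 'I_k -> R,
           (forall x, box_set B x -> \sum_(i < k) c i * b i x = 0) ->
           forall i, c i = 0) &
        (forall u, eigenspace bc B l u -> exists c : 'I_k -> R,
           forall x, box_set B x -> u x = \sum_(i < k) c i * b i x)].

Definition isospectral (R : realType) (n1 n2 : nat) (bc : boundary_condition)
    (B1 : euclidean_box R n1) (B2 : euclidean_box R n2) : Prop :=
  forall (l : R) (k : nat),
    has_multiplicity bc B1 l k <-> has_multiplicity bc B2 l k.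

(* Main.v *)
Require Import Defs.
From mathcomp Require Import all_boot all_order fingroup perm all_algebra.
From mathcomp Require Import all_classical all_reals all_analysis.
From mathcomp Require Import ring lra.
Set Implicit Arguments.
Unset Strict Implicit.
Unset Printing Implicit Defensive.
Import Order.TTheory GRing.Theory Num.Theory.
Import numFieldNormedType.Exports.
Local Open Scope classical_set_scope.
Local Open Scope ring_scope.

(** On a side [[a, b]] of length [L] the operator [- d^2/dt^2] has the
    eigenfunctions [sin ((m + 1) pi (t - a) / L)] (Dirichlet condition) or
    [cos (m pi (t - a) / L)] (Neumann condition), for [m = 0, 1, 2, ...], with
    eigenvalue [(m + e)^2 (pi / L)^2]; the offset [e] is 1 for Dirichlet and 0
    for Neumann.  Products of such functions, one for each side, are
    eigenfunctions of a box.  The proof has two halves.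

    The first half ([has_multiplicity_mode_count]) is that these products span
    all eigenspaces, so the multiplicity of [l] is the number of tuples [m] of
    natural numbers with [\sum_i (m_i + e)^2 (pi / L_i)^2 = l].  It uses
    iterated integrals: the coefficient [coef m u] integrates [u] against the
    product with mode numbers [m], one coordinate after the other.
    - Every coordinate may be integrated first ([integ_swap]), so Green's
      identity on a single side ([green]), applied to each second derivative of
      an eigenfunction [u] for [l], gives [coef m u = 0] unless the eigenvalue
      of the tuple [m] is [l] ([coef_eigenfunction]).
    - A continuous function all of whose coefficients vanish is zero on the
      box ([coef_complete]); one coordinate at a time this is the completeness
      of the trigonometric system on an interval ([mode_complete]).
    - Hence subtracting from [u] its finitely many components along the
      products with eigenvalue [l] leaves zero.

    The second half ([mode_count_inj]) recovers the numbers
    [a_i = (pi / L_i)^2] from these counts.  The least eigenvalue is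
    [e^2 \sum_i a_i], and the distance to the next one is [(1 + 2 e) min_i a_i];
    so the two boxes have the same longest side.  The counts are the
    coefficients of the formal product over [i] of the series
    [\sum_k q^((k + e)^2 a_i)], and a factor of such a product can be cancelled
    ([mode_count_cancel]); removing the longest side from both boxes, induction
    gives the same multiset of side lengths, and in particular the same
    dimension.  A permutation of the coordinates followed by a translation is
    then an isometry. *)

(** * Counting lattice points on ellipsoids *)

Section BoxSpectrum.
Variables (R : realType) (e : nat).
Implicit Types (s t : seq R) (l a : R) (m : seq nat).

(** The eigenvalue with mode number [k] on a side of length [L], where
    [a = (pi / L)^2]; the offset [e] encodes the boundary condition. *)
Definition mode_value (k : nat) a : R := (k + e)%:R ^+ 2 * a.

Fixpoint spectral_value s m : R :=
  match s, m with
  | a :: s', k :: m' => mode_value k a + spectral_value s' m'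
  | _, _ => 0
  end.

(** Since [k <= (k + e)^2], every mode number from this bound on has an
    eigenvalue above [l]; the bound makes the search in [modes] finite. *)
Definition mode_bound l a : nat := (Num.truncn (l / a)).+1.

Fixpoint modes s l : seq (seq nat) :=
  if s is a :: s' then
    flatten [seq [seq k :: m | m <- modes s' (l - mode_value k a)]
            | k <- iota 0 (mode_bound l a)]
  else if l == 0 then [:: [::]] else [::].

Lemma modes_cons a s l : modes (a :: s) l =
  flatten [seq [seq k :: m | m <- modes s (l - mode_value k a)]
          | k <- iota 0 (mode_bound l a)].
Proof. by []. Qed.

Definition positive_seq s : bool := all (fun a => 0 < a) s.

Lemma mode_value_ge0 k a : 0 < a -> 0 <= mode_value k a.
Proof. by move=> a0; rewrite mulr_ge0// ?sqr_ge0 ?ltW. Qed.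

Lemma spectral_value_ge0 s m : positive_seq s -> 0 <= spectral_value s m.
Proof.
elim: s m => [|a s IH] [|k m] //= /andP[a0 s0].
by rewrite addr_ge0 ?mode_value_ge0// IH.
Qed.

Lemma mode_boundP l a k : 0 < a -> (mode_bound l a <= k)%N ->
  l < mode_value k a.
Proof.
move=> a0 bk; rewrite /mode_value -ltr_pdivrMr//.
apply: (@lt_le_trans _ _ (mode_bound l a)%:R); first exact: truncnS_gt.
apply: (@le_trans _ _ (k + e)%:R).
  by rewrite ler_nat (leq_trans bk)// leq_addr.
by rewrite -natrX ler_nat -[leqLHS]expn1; case: (k + e)%N => // p; rewrite leq_pexp2l.
Qed.

Lemma mem_modes s l m : positive_seq s ->
  (m \in modes s l) = (size m == size s) && (spectral_value s m == l).
Proof.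
elim: s l m => [|a s IH] l m.
  by move=> _ /=; case: (eqVneq l 0) => _; case: m => [|k m]; rewrite ?inE.
rewrite modes_cons => /andP[a0 s0]; apply/flatten_mapP/idP.
  move=> [k _ /mapP[m' + ->]]; rewrite IH// => /andP[/eqP sm /eqP vm] /=.
  by rewrite sm eqxx/= vm addrC subrK.
case: m => // k m /andP[/eqP[/eqP sm] /eqP vm]; rewrite /= in vm.
exists k; last by apply: map_f; rewrite IH// sm -vm addrAC subrr add0r eqxx.
rewrite mem_iota add0n ltnNge; apply/negP => /(mode_boundP a0).
by rewrite -vm ltNge lerDl spectral_value_ge0.
Qed.

Lemma modes_uniq s l : uniq (modes s l).
Proof.
elim: s l => [|a s IH] l; [by rewrite /=; case: ifP | rewrite modes_cons].
move: (iota _ _) (iota_uniq 0 (mode_bound l a)) => r.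
elim: r => //= k r IHr /andP[kr ur]; rewrite cat_uniq IHr// andbT.
rewrite map_inj_uniq ?IH//=; last by move=> x y [].
apply/hasPn => m /flatten_mapP[j jr /mapP[m' _ ->]].
by apply/mapP => -[m'' _ [jk _]]; rewrite -jk jr in kr.
Qed.

Definition mode_count s l : nat := size (modes s l).

Lemma mode_count_gt0P s l : positive_seq s ->
  reflect (exists2 m, size m = size s & spectral_value s m = l)
    (0 < mode_count s l)%N.
Proof.
move=> s0; rewrite /mode_count lt0n size_eq0; apply: (iffP idP).
  case E : (modes s l) => [//|m r] _; exists m.
    by have := mem_modes l m s0; rewrite E mem_head => /esym/andP[/eqP].
  by have := mem_modes l m s0; rewrite E mem_head => /esym/andP[_ /eqP].
move=> [m sm vm]; apply/eqP => E.
by have := mem_modes l m s0; rewrite E in_nil sm vm !eqxx.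
Qed.

Lemma mode_count_neg s l : positive_seq s -> l < 0 -> mode_count s l = 0%N.
Proof.
move=> s0 l0; apply/eqP; rewrite -leqn0 leqNgt; apply/negP => /mode_count_gt0P -/(_ s0)[m _ vm].
by have := spectral_value_ge0 m s0; rewrite vm leNgt l0.
Qed.

(** The bound [N] is free above [mode_bound l a], because the extra terms count
    the tuples of a negative eigenvalue; a common bound for two sides is what
    lets the two sums of [mode_count_swap] be exchanged. *)
Lemma mode_count_cons a s l N : positive_seq (a :: s) -> (mode_bound l a <= N)%N ->
  mode_count (a :: s) l = (\sum_(0 <= k < N) mode_count s (l - mode_value k a))%N.
Proof.
move=> /= /andP[a0 s0] bN.
rewrite (big_cat_nat (n := mode_bound l a))//= [X in (_ + X)%N]big1_seq ?addn0.
  rewrite /mode_count modes_cons size_flatten /shape -map_comp sumnE big_map /index_iota subn0.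
  by apply: eq_bigr => k _; rewrite /= size_map.
move=> k /andP[_]; rewrite mem_index_iota => /andP[bk _].
by rewrite mode_count_neg// subr_lt0; exact: mode_boundP.
Qed.

Lemma mode_count_swap a b s l : positive_seq [:: a, b & s] ->
  mode_count [:: a, b & s] l = mode_count [:: b, a & s] l.
Proof.
move=> /= /and3P[a0 b0 s0].
have le_bound x y z : 0 < z -> x <= y -> (mode_bound x z <= mode_bound y z)%N.
  by move=> z0 xy; rewrite ltnS le_truncn// ler_pM2r ?invr_gt0.
pose N := maxn (mode_bound l a) (mode_bound l b).
have Na : (mode_bound l a <= N)%N by exact: leq_maxl.
have Nb : (mode_bound l b <= N)%N by exact: leq_maxr.
have sub x c k : 0 < c -> x - mode_value k c <= x.
  by move=> c0; rewrite lerBlDr lerDl mode_value_ge0.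
rewrite (mode_count_cons (N := N))//= ?a0 ?b0//.
rewrite [RHS](mode_count_cons (N := N))//= ?a0 ?b0//.
under eq_bigr => k _.
  rewrite (mode_count_cons (N := N)) ?b0/= ?b0 ?s0//; first over.
  by rewrite (leq_trans _ Nb)// le_bound ?sub.
under [RHS]eq_bigr => k _.
  rewrite (mode_count_cons (N := N)) ?a0/= ?a0 ?s0//; first over.
  by rewrite (leq_trans _ Na)// le_bound ?sub.
rewrite exchange_big/=; apply: eq_bigr => i _; apply: eq_bigr => j _.
by rewrite addrAC.
Qed.

Lemma mode_count_cat_cons s a t l : positive_seq (s ++ a :: t) ->
  mode_count (s ++ a :: t) l = mode_count (a :: s ++ t) l.
Proof.
elim: s l => //= b s IH l /andP[b0 st0].
have st0' := st0.
move: st0'; rewrite /positive_seq all_cat/= => /and3P[s0 a0 t0].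
rewrite -[RHS]mode_count_swap/=; last by rewrite b0 a0 /positive_seq all_cat s0.
rewrite (mode_count_cons (N := mode_bound l b))//= ?b0//.
rewrite [RHS](mode_count_cons (N := mode_bound l b))//=; last first.
  by rewrite b0 a0 /positive_seq all_cat s0.
by apply: eq_bigr => k _; apply: IH.
Qed.

(** The least eigenvalue: all mode numbers are 0. *)
Definition ground s : R := \sum_(a <- s) mode_value 0 a.

Lemma spectral_value_nseq0 s : spectral_value s (nseq (size s) 0%N) = ground s.
Proof.
rewrite /ground; elim: s => [|a s IH]/=; first by rewrite big_nil.
by rewrite big_cons IH.
Qed.

Lemma mode_value_homo a i j : 0 < a -> (i <= j)%N ->
  mode_value i a <= mode_value j a.
Proof.
move=> a0 ij; rewrite ler_pM2r// -!natrX ler_nat leq_exp2r//.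
by rewrite leq_add2r.
Qed.

Lemma ground_le s m : positive_seq s -> size m = size s ->
  ground s <= spectral_value s m.
Proof.
rewrite /ground; elim: s m => [|a s IH] [|k m] //=; first by rewrite big_nil.
by move=> /andP[a0 s0] [sm]; rewrite big_cons lerD ?IH// mode_value_homo.
Qed.

Lemma ground_le_of_mode_count s l : positive_seq s -> (0 < mode_count s l)%N -> ground s <= l.
Proof. by move=> s0 /mode_count_gt0P -/(_ s0)[m sm <-]; exact: ground_le. Qed.

Lemma mode_count_ground_gt0 s : positive_seq s -> (0 < mode_count s (ground s))%N.
Proof.
move=> s0; apply/mode_count_gt0P => //; exists (nseq (size s) 0%N); first by rewrite size_nseq.
exact: spectral_value_nseq0.
Qed.

Definition gap a : R := mode_value 1 a - mode_value 0 a.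

Lemma gapE a : gap a = (1 + e.*2)%:R * a.
Proof. by rewrite /gap /mode_value -addnn !natrD; ring. Qed.

Lemma mode_count_gap_gt0 a s : positive_seq (a :: s) ->
  (0 < mode_count (a :: s) (ground (a :: s) + gap a))%N.
Proof.
move=> s0; apply/mode_count_gt0P => //; exists (1%N :: nseq (size s) 0%N) => /=.
  by rewrite size_nseq.
by rewrite spectral_value_nseq0 /ground big_cons /gap; ring.
Qed.

(** Raising some mode number from 0 to at least 1 costs at least the gap of
    that side, and gaps increase with [a]. *)
Lemma spectral_value_gap s m b : positive_seq s -> size m = size s ->
  (forall a, a \in s -> b <= a) -> spectral_value s m != ground s ->
  ground s + gap b <= spectral_value s m.
Proof.
elim: s m => [|a s IH] [|k m] //=; first by rewrite /ground big_nil eqxx.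
move=> /andP[a0 s0] [sm] ble; rewrite /ground big_cons => ne.
case: k ne => [|k] ne.
  rewrite -addrA lerD2l IH//; first by move=> c cs; apply: ble; rewrite inE cs orbT.
  by apply: contra_neq ne => ->.
rewrite addrAC lerD//; last exact: ground_le.
apply: (@le_trans _ _ (mode_value 1 a)); last exact: mode_value_homo.
rewrite addrC -lerBrDr -/(gap a) !gapE ler_pM2l; last by rewrite ltr0n.
by apply: ble; rewrite mem_head.
Qed.

Lemma gap_le_of_mode_count s b l : positive_seq s ->
  (forall a, a \in s -> b <= a) -> (0 < mode_count s l)%N -> l != ground s ->
    ground s + gap b <= l.
Proof.
move=> s0 ble /mode_count_gt0P -/(_ s0)[m sm <-] ne.
exact: spectral_value_gap.
Qed.

(** In the sum of [mode_count_cons] at [l + mode_value 0 a] the term [k = 0] is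
    the count of [l] without the side [a], and the other terms are counts at
    values at most [l - a].  So the counts without [a] are determined by
    induction on the integral part of [l / a]. *)
Lemma mode_count_cancel a s t : positive_seq (a :: s) -> positive_seq (a :: t) ->
  mode_count (a :: s) =1 mode_count (a :: t) -> mode_count s =1 mode_count t.
Proof.
move=> as0 at0 E.
have /andP[a0 s0] := as0; have /andP[_ t0] := at0.
suff H N l : l < N%:R * a -> mode_count s l = mode_count t l.
  move=> l; apply: (H (mode_bound l a)).
  by rewrite -ltr_pdivrMr//; exact: truncnS_gt.
elim: N l => [l|N IH l lN]; first by rewrite mul0r => l0; rewrite !mode_count_neg.
have := E (l + mode_value 0 a).
rewrite !(mode_count_cons (N := (mode_bound (l + mode_value 0 a) a)))//.
rewrite /mode_bound !big_nat_recl//= addrK.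
set A := (\sum_(0 <= i < _) _)%N; set B := (\sum_(0 <= i < _) _)%N.
suff -> : A = B by move/addIn.
apply: eq_big_nat => k _; apply: IH.
have : mode_value 0 a + a <= mode_value k.+1 a.
  apply: (@le_trans _ _ (mode_value 1 a)); last exact: mode_value_homo.
  rewrite -lerBrDl -/(gap a) gapE -[leLHS]mul1r ler_pM2r// ler1n.
  by rewrite add1n.
rewrite -natr1 mulrDl mul1r in lN.
by move=> ?; lra.
Qed.

Lemma mode_count_perm_min s : positive_seq s -> s != [::] ->
  exists a t, [/\ perm_eq s (a :: t), mode_count s =1 mode_count (a :: t) &
                  forall b, b \in s -> a <= b].
Proof.
move=> s0 sn; have : exists2 a, a \in s & forall b, b \in s -> a <= b.
  elim: s {s0} sn => // a [|c s] IH _.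
    by exists a; [rewrite mem_head | move=> b /[1!inE]/eqP ->].
  have [//|d ds dle] := IH.
  have [da|ad] := leP d a.
    exists d; first by rewrite inE ds orbT.
    by move=> b; rewrite inE => /orP[/eqP ->//|]; exact: dle.
  exists a; first by rewrite mem_head.
  move=> b; rewrite inE => /orP[/eqP ->//|/dle]; apply: le_trans; exact: ltW.
move=> [a as_ amin]; case/splitPr: as_ s0 amin {sn} => p q s0 amin.
exists a, (p ++ q); split => //; last by move=> l; apply: mode_count_cat_cons.
by rewrite perm_catC/= perm_cons perm_catC.
Qed.

(** Without sides 0 is the only eigenvalue, whereas a side produces at least
    two of them. *)
Lemma mode_count_nil_cons a s : positive_seq (a :: s) ->
  ~ (mode_count [::] =1 mode_count (a :: s)).
Proof.
move=> as0 E; have /andP[a0 s0] := as0.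
have nil0 l : (0 < mode_count [::] l)%N -> l = 0 by rewrite /mode_count/=; case: eqVneq.
have /nil0 g0 : (0 < mode_count [::] (ground (a :: s)))%N.
  by rewrite E mode_count_ground_gt0.
have /nil0 : (0 < mode_count [::] (ground (a :: s) + gap a))%N.
  by rewrite E mode_count_gap_gt0.
rewrite g0 add0r gapE => /eqP; rewrite mulf_eq0 gt_eqF ?ltr0n// gt_eqF//.
Qed.

(** The number of sides is part of the conclusion; the smallest entry of [s] is
    read off from the first gap, and then cancelled. *)
Theorem mode_count_inj s t : positive_seq s -> positive_seq t ->
  mode_count s =1 mode_count t -> perm_eq s t.
Proof.
elim: {s}(size s) {-2}s (erefl (size s)) t => [|n IH] s.
  move=> /size0nil -> [|b t] // _ t0 E; exfalso; exact: (mode_count_nil_cons t0 E).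
move=> sn t s0 t0 E.
have [|a [s' [ps Es mins]]] := mode_count_perm_min s0; first by rewrite -size_eq0 sn.
have as0 : positive_seq (a :: s') by rewrite /positive_seq -(perm_all _ ps).
have [|b [t' [pt Et mint]]] := mode_count_perm_min t0.
  apply/eqP => t_nil; apply: (mode_count_nil_cons as0) => l; rewrite -Es E t_nil//.
have bt0 : positive_seq (b :: t') by rewrite /positive_seq -(perm_all _ pt).
have gg : ground s = ground t.
  apply/le_anti/andP; split; apply: ground_le_of_mode_count => //.
    by rewrite E mode_count_ground_gt0.
  by rewrite -E mode_count_ground_gt0.
have gapgt0 c : 0 < c -> 0 < gap c by move=> c0; rewrite gapE mulr_gt0// ltr0n.
have ground_perm u v : perm_eq u v -> ground u = ground v by exact: perm_big.
(* the first gap of [u] is an eigenvalue of [v], so it is at least that of [v] *)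
have key u c v d w : positive_seq u -> perm_eq u (c :: w) ->
  mode_count u =1 mode_count (c :: w) ->
    positive_seq (c :: w) -> positive_seq v -> (forall x, x \in v -> d <= x) ->
    ground u = ground v -> mode_count u =1 mode_count v -> d <= c.
  move=> u0 pu Eu cw0 v0 dv guv Euv; have /andP[c0 _] := cw0.
  have : (0 < mode_count v (ground u + gap c))%N.
    by rewrite -Euv Eu (ground_perm _ _ pu) mode_count_gap_gt0.
  move=> /(gap_le_of_mode_count v0 dv); rewrite -guv lerD2l !gapE ler_pM2l ?ltr0n//.
  by apply; rewrite -subr_eq0 addrC addKr -gapE gt_eqF ?gapgt0.
have ab : a = b.
  apply/le_anti/andP; split.
    by apply: (key t b s a t') => // l; rewrite E.
  exact: (key s a t b s').
subst b; rewrite (perm_trans ps)// perm_sym (perm_trans pt)// perm_cons perm_sym.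
have ps' : size s' = n by have := perm_size ps; rewrite sn/= => -[].
apply: IH => //; [by case/andP: as0 | by case/andP: bt0 |].
by apply: (mode_count_cancel as0 bt0) => l; rewrite -Es E.
Qed.

End BoxSpectrum.

(** * Integrals of continuous functions over an interval *)

Section Integral.
Variable R : realType.
Notation mu := (@lebesgue_measure R).
Implicit Types (a b c : R) (f g F : R -> R).

(** The open interval makes the integral depend only on the values of [f]
    inside, where alone the derivatives of an eigenfunction make sense. *)
Definition integ a b f : R := (\int[mu]_(x in `]a, b[) f x)%R.

Lemma integrable_oo a b f : continuous f ->
  mu.-integrable `]a, b[ (EFin \o f).
Proof.
move=> cf; apply: (@integrableS _ _ _ mu `[a, b]) => //.
  exact: subset_itv_oo_cc.
apply: continuous_compact_integrable; first exact: segment_compact.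
exact: continuous_subspaceT.
Qed.

Lemma eq_integ a b f g : {in `]a, b[, f =1 g} -> integ a b f = integ a b g.
Proof. by move=> fg; apply: eq_Rintegral => x; rewrite inE/= => /fg. Qed.

Lemma integD a b f g : continuous f -> continuous g ->
  integ a b (fun x => f x + g x) = integ a b f + integ a b g.
Proof. by move=> cf cg; rewrite /integ RintegralD//; exact: integrable_oo. Qed.

Lemma integZ a b k f : continuous f ->
  integ a b (fun x => k * f x) = k * integ a b f.
Proof. by move=> cf; rewrite /integ RintegralZl//; exact: integrable_oo. Qed.

Lemma integB a b f g : continuous f -> continuous g ->
  integ a b (fun x => f x - g x) = integ a b f - integ a b g.
Proof. by move=> cf cg; rewrite /integ RintegralB//; exact: integrable_oo. Qed.

Lemma integ0 a b : integ a b (fun=> 0) = 0.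
Proof. by rewrite /integ Rintegral_cst// mul0r. Qed.

Lemma integ_cst a b k : a <= b -> integ a b (fun=> k) = k * (b - a).
Proof.
move=> ab; rewrite /integ Rintegral_cst//= lebesgue_measure_itv/= lte_fin.
by case: ltP => //= ba; congr (_ * _); apply/eqP; lra.
Qed.

Lemma integ_le a b f g : continuous f -> continuous g ->
  {in `]a, b[, forall x, f x <= g x} -> integ a b f <= integ a b g.
Proof.
by move=> cf cg fg; apply: le_Rintegral => //; exact: integrable_oo.
Qed.

Lemma integ_norm_le a b f M : a <= b -> continuous f ->
  {in `]a, b[, forall x, `|f x| <= M} -> `|integ a b f| <= M * (b - a).
Proof.
move=> ab cf fM; rewrite ler_norml -mulNr -!integ_cst//.
apply/andP; split; apply: integ_le => //; try exact: cst_continuous.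
  by move=> x /fM; rewrite ler_norml => /andP[].
by move=> x /fM; rewrite ler_norml => /andP[].
Qed.

Lemma integ_FTC a b F f : a < b -> {within `[a, b], continuous F} -> continuous f ->
  {in `]a, b[, forall x : R, is_derive x 1 F (f x)} -> integ a b f = F b - F a.
Proof.
move=> ab cF cf dF.
have -> : integ a b f = (\int[mu]_(x in `[a, b]) f x)%R.
  have icc : mu.-integrable `[a, b] (EFin \o f).
    apply: continuous_compact_integrable; first exact: segment_compact.
    exact: continuous_subspaceT.
  rewrite /integ Rintegral_itv_bndo_bndc; last exact: integrable_oo.
  rewrite Rintegral_itv_obnd_cbnd//.
  by apply: integrableS icc => //; exact: subset_itv_oc_cc.
rewrite /Rintegral (@continuous_FTC2 _ f F)//=.
- exact: continuous_subspaceT.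
- have [_ cFa cFb] := (continuous_within_itvP _ ab).1 cF.
  by split => // x /dF [].
- by move=> x /dF ?; rewrite derive1E derive_val.
Qed.

Lemma is_derive_integ c z f : c < z -> continuous f ->
  is_derive z 1 (fun y => integ c y f) (f z).
Proof.
move=> cz cf.
have -> : (fun y => integ c y f) = (fun y => \int[mu]_(t in `]c, y]) f t)%R.
  by apply/funext => y; rewrite /integ Rintegral_itv_bndo_bndc//; exact: integrable_oo.
have [||||d1 d2] := @continuous_FTC1 R f (BRight c) z (z + 1).
- by rewrite ltrDl.
- apply: (@integrableS _ _ _ mu `[c, z + 1]) => //; first exact: subset_itv_oc_cc.
  apply: continuous_compact_integrable; first exact: segment_compact.
  exact: continuous_subspaceT.
- exact: cz.
- exact: cf.
by apply: DeriveDef; [exact: d1 | rewrite -derive1E; exact: d2].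
Qed.

Lemma is_derive_continuous (f df : R -> R) :
  (forall x : R, is_derive x 1 f (df x)) -> continuous f.
Proof.
move=> dfE x; apply/differentiable_continuous/derivable1_diffP.
by case: (dfE x).
Qed.

(** By compactness of [[a, b]], [h x] is uniformly close to [h x0] on it when
    [x] is close to [x0]. *)
Lemma continuous_integ_param (T : topologicalType) (h : T -> R -> R) a b :
  a < b -> continuous (fun p : T * R => h p.1 p.2) ->
  continuous (fun x => integ a b (h x)).
Proof.
move=> ab ch x0.
have cx x : continuous (h x).
  by move=> t; exact: (continuous2_cvg (f := (fun=> x)) (g := id)
    (h := h) _ (ch (x, t)) (cvg_cst x) cvg_id).
apply/cvgrPdist_le => e e0.
pose d := e / (b - a).
have d0 : 0 < d by rewrite divr_gt0// subr_gt0.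
have /compact_near_coveringP cov : compact `[a, b] by exact: segment_compact.
have H : \forall x \near x0, `[a, b] `<=` (fun t => `|h x0 t - h x t| <= d).
  apply: cov => t _.
  have /cvgrPdist_le/(_ (d / 2)) := ch (x0, t);
    rewrite divr_gt0// => /(_ isT) /= [[U V] /= [nU nV] UV].
  exists (V, U) => //= -[t' x] /= [Vt' Ux].
  have h1 := UV (x0, t') (conj (nbhs_singleton nU) Vt').
  have h2 := UV (x, t') (conj Ux Vt').
  rewrite /= in h1 h2.
  rewrite (_ : h x0 t' - h x t' = (h x0 t - h x t') - (h x0 t - h x0 t')); last by ring.
  by rewrite (le_trans (ler_normB _ _))// [leRHS](splitr d) lerD.
near=> x; rewrite -integB//.
have -> : e = d * (b - a) by rewrite /d divfK// subr_eq0 gt_eqF.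
apply: integ_norm_le; first exact: ltW.
  by move=> t; apply: cvgB; exact: cx.
move=> t tab; have : `[a, b] `<=` (fun t => `|h x0 t - h x t| <= d) by near: x.
by apply; exact: subset_itv_oo_cc tab.
Unshelve. all: by end_near. Qed.

(** As functions of the upper bound [z] of the integral over [s], both sides have
    the derivative [integ c d (h z)]: on the right by differentiation under the
    integral sign. *)
Lemma integ_swap (h : R -> R -> R) a b c d : a < b -> c < d ->
  continuous (fun p : R * R => h p.1 p.2) ->
  integ a b (fun s => integ c d (h s)) =
  integ c d (fun t => integ a b (h ^~ t)).
Proof.
move=> ab cd ch.
have cfst s : continuous (h s).
  by move=> t; exact: (continuous2_cvg (f := (fun=> s)) (g := id)
    (h := h) _ (ch (s, t)) (cvg_cst s) cvg_id).
have csnd t : continuous (h ^~ t).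
  by move=> s; exact: (continuous2_cvg (f := id) (g := (fun=> t))
    (h := h) _ (ch (s, t)) cvg_id (cvg_cst t)).
have cint z : a - 1 < z -> continuous (fun t => integ (a - 1) z (h ^~ t)).
  move=> az; apply: (@continuous_integ_param R (fun t s => h s t)) => //.
  by move=> [t s]; exact: (continuous2_cvg (f := snd) (g := fst)
    (h := h) _ (ch (s, t)) cvg_snd cvg_fst).
(* the lower bound [a - 1] makes [G] differentiable on a neighbourhood of [a] *)
pose G z := integ c d (fun t => integ (a - 1) z (h ^~ t)).
have [M hM] : exists M, forall s t, s \in `[a - 1, b + 1] -> t \in `[c, d] -> `|h s t| <= M.
  have := @compact_setX _ _ _ _ (@segment_compact R (a - 1) (b + 1)) (@segment_compact R c d).
  move=> /(continuous_compact (continuous_subspaceT ch)) /compact_bounded.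
  move=> [M [_ /(_ (M + 1))]]; rewrite ltrDl => /(_ ltr01) H; exists (M + 1) => s t sI tI.
  by apply: H; exists (s, t).
have dG z : z \in `]a - 1, b + 1[ -> is_derive z 1 G (integ c d (h z)).
  move=> zI.
  have d1 x t : a - 1 < x -> is_derive x 1 (fun z => integ (a - 1) z (h ^~ t)) (h x t).
    by move=> ax; exact: is_derive_integ.
  have ea x t : x \in `]a - 1, b + 1[ ->
    partial1of2 (fun z t => integ (a - 1) z (h ^~ t)) x t = h x t.
    rewrite in_itv => /andP[ax xb]; rewrite partial1of2E; have := d1 x t ax.
    by move=> ?; rewrite derive_val.
  have A1 x : `]a - 1, b + 1[%classic x ->
      mu.-integrable `]c, d[ (EFin \o (fun t => integ (a - 1) x (h ^~ t))).
    by rewrite /= in_itv/= => /andP[ax _]; apply: integrable_oo; exact: cint.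
  have A2 x t : `]a - 1, b + 1[%classic x -> `]c, d[%classic t ->
      derivable ((fun z t => integ (a - 1) z (h ^~ t)) ^~ t) x 1.
    by rewrite /= in_itv/= => /andP[ax _] _; case: (d1 x t ax).
  have A3 : mu.-integrable `]c, d[ (EFin \o (fun=> `|M|)).
    by apply: integrable_oo; exact: cst_continuous.
  have A4 x t : `]a - 1, b + 1[%classic x -> `]c, d[%classic t ->
      `|partial1of2 (fun z t => integ (a - 1) z (h ^~ t)) x t| <= `|M|.
    move=> xI tI; rewrite ea// (le_trans _ (ler_norm M))// hM//.
      exact: subset_itv_oo_cc xI.
    exact: subset_itv_oo_cc tI.
  have mI : measurable (`]c, d[%classic : set R) by [].
  have := @derivable_under_integral R _ _ mu _ `]c, d[ mI z _ _
    zI A1 A2 (fun=> `|M|) (fun=> normr_ge0 _) A3 A4.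
  have := @differentiation_under_integral R _ _ mu _ `]c, d[ mI z _ _
    zI A1 A2 (fun=> `|M|) (fun=> normr_ge0 _) A3 A4.
  move=> E D; apply: DeriveDef => //; rewrite -derive1E E.
  by apply: eq_integ => t _; rewrite ea.
have derivable_within (p dp : R -> R) :
    {in `]a - 1, b + 1[, forall x : R, is_derive x 1 p (dp x)} ->
    {within `[a, b], continuous p}.
  move=> H; apply: derivable_within_continuous => x; rewrite in_itv/= => xab.
  have /H[//] : x \in `]a - 1, b + 1[ by rewrite in_itv/=; lra.
have subI x : x \in `]a, b[ -> x \in `]a - 1, b + 1[ by rewrite !in_itv/=; lra.
rewrite (@integ_FTC a b G)//; last 3 first.
- exact: derivable_within dG.
- exact: continuous_integ_param.
- by move=> x /subI; exact: dG.
rewrite /G -integB; [|by apply: cint; lra..].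
apply: eq_integ => t _.
have dH : {in `]a - 1, b + 1[, forall x : R,
    is_derive x 1 (fun z => integ (a - 1) z (h ^~ t)) (h x t)}.
  by move=> x; rewrite in_itv/= => /andP[ax _]; exact: is_derive_integ.
rewrite (@integ_FTC a b (fun z => integ (a - 1) z (h ^~ t)) (h ^~ t))//.
  exact: derivable_within dH.
by move=> x /subI; exact: dH.
Qed.

End Integral.

(** * Completeness of the trigonometric system *)

Section Continuity.
Variables (R : realType) (T : topologicalType).
Implicit Types f g : T -> R.

Lemma continuous_fun_mul f g : continuous f -> continuous g ->
  continuous (fun x => f x * g x).
Proof. by move=> cf cg x; apply: cvgM; [exact: cf|exact: cg]. Qed.

Lemma continuous_fun_add f g : continuous f -> continuous g ->
  continuous (fun x => f x + g x).
Proof. by move=> cf cg x; apply: cvgD; [exact: cf|exact: cg]. Qed.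

Lemma continuous_fun_opp f : continuous f -> continuous (fun x => - f x).
Proof. by move=> cf x; apply: cvgN; exact: cf. Qed.

Lemma continuous_fun_exp f n : continuous f -> continuous (fun x => f x ^+ n).
Proof.
move=> cf; elim: n => [|n IH].
  by rewrite [X in continuous X](_ : _ = cst 1); [exact: cst_continuous|apply/funext].
have -> : (fun x => f x ^+ n.+1) = (fun x => f x * f x ^+ n).
  by apply/funext => x; rewrite exprS.
exact: continuous_fun_mul.
Qed.

Lemma continuous_fun_comp f (h : R -> R) : continuous h -> continuous f ->
  continuous (fun x => h (f x)).
Proof. by move=> ch cf x; apply: continuous_comp; [exact: cf|exact: ch]. Qed.

Lemma continuous_fun_sum (I : Type) (r : seq I) (P : pred I) (F : I -> T -> R) :
  (forall i, continuous (F i)) -> continuous (fun x => \sum_(i <- r | P i) F i x).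
Proof.
move=> cF; elim: r => [|i r IH].
  have -> : (fun x => \sum_(i <- [::] | P i) F i x) = cst 0.
    by apply/funext => x; rewrite big_nil.
  exact: cst_continuous.
have -> : (fun x => \sum_(i <- i :: r | P i) F i x) =
    (fun x => (if P i then F i x else 0) + \sum_(i <- r | P i) F i x).
  by apply/funext => x; rewrite big_cons; case: ifP => //; rewrite add0r.
apply: continuous_fun_add => //; case: (P i) => //; exact: cst_continuous.
Qed.

Lemma continuous_fun_prod (I : Type) (r : seq I) (P : pred I) (F : I -> T -> R) :
  (forall i, continuous (F i)) -> continuous (fun x => \prod_(i <- r | P i) F i x).
Proof.
move=> cF; elim: r => [|i r IH].
  have -> : (fun x => \prod_(i <- [::] | P i) F i x) = cst 1.
    by apply/funext => x; rewrite big_nil.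
  exact: cst_continuous.
have -> : (fun x => \prod_(i <- i :: r | P i) F i x) =
    (fun x => (if P i then F i x else 1) * \prod_(i <- r | P i) F i x).
  by apply/funext => x; rewrite big_cons; case: ifP => //; rewrite mul1r.
apply: continuous_fun_mul => //; case: (P i) => //; exact: cst_continuous.
Qed.

End Continuity.

(** Continuity of explicit expressions.  The head operation is matched
    syntactically, so that no rule is tried up to unfolding of the functions. *)
Ltac cont_step := lazymatch goal with
  | |- continuous ?F => lazymatch F with
    | (fun x => GRing.add (@?f x) (@?g x)) =>
        simple refine (@continuous_fun_add _ _ f g _ _)
    | (fun x => GRing.mul (@?f x) (@?g x)) =>
        simple refine (@continuous_fun_mul _ _ f g _ _)
    | (fun x => GRing.opp (@?f x)) =>
        simple refine (@continuous_fun_opp _ _ f _)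
    | (fun x => GRing.exp (@?f x) ?n) =>
        simple refine (@continuous_fun_exp _ _ f n _)
    | (fun x => cos (@?f x)) =>
        simple refine (@continuous_fun_comp _ _ f cos (@continuous_cos _) _)
    | (fun x => sin (@?f x)) =>
        simple refine (@continuous_fun_comp _ _ f sin (@continuous_sin _) _)
    | (fun x => x) => (move=> ?; exact: cvg_id)
    | (fun x => ?c) => exact: cst_continuous
    | (fun x => ?h (@?f x)) => assumption
    | _ => assumption
    end
  | _ => assumption
  end.
Ltac cont_tac := repeat cont_step.

Section CosineCompleteness.
Variable R : realType.
Implicit Types (a b : R) (f g q : R -> R).

Lemma integ_subset a b c d f : a <= c -> d <= b -> continuous f ->
  {in `]a, b[, forall x, 0 <= f x} -> integ c d f <= integ a b f.
Proof.
move=> ac db cf f0; rewrite /integ /Rintegral fine_le//.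
- by apply: integrable_fin_num => //; exact: integrable_oo.
- by apply: integrable_fin_num => //; exact: integrable_oo.
apply: ge0_subset_integral => //=.
- by have /integrableP[] := @integrable_oo R a b f cf.
- by apply: subset_itv; rewrite bnd_simp.
Qed.

Lemma bernoulli_le (x : R) n : 0 <= x -> 1 + n%:R * x <= (1 + x) ^+ n.
Proof.
move=> x0; elim: n => [|n IH]; first by rewrite mul0r addr0 expr0.
rewrite exprS; apply: le_trans (ler_wpM2l _ IH); last lra.
have : 0 <= n%:R * x * x by rewrite !mulr_ge0.
rewrite -natr1; nra.
Qed.

(** If [T] exceeds [1 + k] on an interval where [g] is at least [k], then there
    [g * T ^ n] is at least [k * (1 + k) ^ n]; elsewhere it is bounded below
    independently of [n], because [T <= 1] wherever [g] may be negative.  So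
    the integrals of [g * T ^ n] tend to infinity. *)
Lemma peak_contradiction a b (g T : R -> R) t0 r (k : R) :
  a < b -> continuous g -> continuous T ->
  0 < r -> a <= t0 - r -> t0 + r <= b -> 0 < k ->
  (forall t, t \in `]a, b[ -> 0 <= T t) ->
  (forall t, t \in `]a, b[ -> (T t <= 1) || (0 <= g t)) ->
  (forall t, t \in `]t0 - r, t0 + r[ -> k <= g t /\ 1 + k <= T t) ->
  (forall n, integ a b (fun t => g t * T t ^+ n) = 0) -> False.
Proof.
move=> ab cg cT r0 ar rb k0 T0 T1 TJ orth.
have [M gM] : exists M, forall t, t \in `[a, b] -> `|g t| <= M.
  have /compact_bounded[M [_ /(_ (M + 1))]] :=
    continuous_compact (continuous_subspaceT cg) (@segment_compact R a b).
  by rewrite ltrDl => /(_ ltr01) H; exists (M + 1) => t tI; apply: H; exists t.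
have M0 : 0 <= M.
  by apply: le_trans (normr_ge0 (g a)) (gM a _); rewrite in_itv/= lexx ltW.
have cM n : continuous (fun t => g t * T t ^+ n + M) by cont_tac.
have bound n : k * (1 + n%:R * k) * (2 * r) <= M * (b - a).
  have <- : integ a b (fun t => g t * T t ^+ n + M) = M * (b - a).
    rewrite integD; [|by cont_tac..].
    by rewrite orth add0r integ_cst// ltW.
  apply: (@le_trans _ _ (integ (t0 - r) (t0 + r) (fun t => g t * T t ^+ n + M))).
    rewrite (_ : 2 * r = (t0 + r) - (t0 - r)); last by ring.
    rewrite -integ_cst; last lra.
    apply: integ_le; [exact: cst_continuous|exact: cM|move=> t tJ].
    have [kg kT] := TJ t tJ.
    rewrite -[leLHS]addr0 lerD// ler_pM//; first exact: ltW.
      by rewrite addr_ge0// mulr_ge0// ltW.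
    by rewrite (le_trans (bernoulli_le _ (ltW k0)))// lerXn2r// nnegrE; lra.
  apply: integ_subset => // t tI.
  have gt : `|g t| <= M by apply: gM; exact: subset_itv_oo_cc tI.
  have Tn0 : 0 <= T t ^+ n by rewrite exprn_ge0// T0.
  have /orP[Tt|gt0] := T1 t tI; last by rewrite addr_ge0// mulr_ge0.
  have Tn1 : T t ^+ n <= 1 by rewrite exprn_ile1// T0.
  rewrite -lerBlDr sub0r; move: gt; rewrite ler_norml => /andP[g1 _].
  nra.
have kr : 0 < k * k * (2 * r) by rewrite !mulr_gt0.
pose n := (Num.truncn (M * (b - a) / (k * k * (2 * r)))).+1.
have : M * (b - a) < n%:R * (k * k * (2 * r)).
  by rewrite -ltr_pdivrMr//; exact: truncnS_gt.
have := bound n; nra.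
Qed.

Variables a b : R.
Hypothesis ab : a < b.
Let w : R := pi / (b - a).
Let phase (t : R) : R := w * (t - a).

Lemma cos_mul_succ (m : nat) (x : R) :
  cos x * cos (m.+1%:R * x) = 2^-1 * cos (m.+2%:R * x) + 2^-1 * cos (m%:R * x).
Proof.
have -> : m.+2%:R * x = m.+1%:R * x + x by rewrite -natr1; ring.
have -> : m%:R * x = m.+1%:R * x - x by rewrite -natr1; ring.
by rewrite cosB cosD; field.
Qed.

Lemma sin_mul_succ (m : nat) (x : R) :
  sin x * cos (m.+1%:R * x) = 2^-1 * sin (m.+2%:R * x) - 2^-1 * sin (m%:R * x).
Proof.
have -> : m.+2%:R * x = m.+1%:R * x + x by rewrite -natr1; ring.
have -> : m%:R * x = m.+1%:R * x - x by rewrite -natr1; ring.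
by rewrite sinB sinD; field.
Qed.

Lemma phase_itv t : t \in `[a, b] -> phase t \in `[0, pi].
Proof.
rewrite !in_itv/= /phase /w => /andP[at_ tb].
have ba : 0 < b - a by rewrite subr_gt0.
rewrite mulr_ge0 ?subr_ge0//=; last by rewrite divr_ge0// ?pi_ge0// ltW.
by rewrite mulrAC -mulrA ler_piMr ?pi_ge0// ler_pdivrMr// mul1r lerB.
Qed.

Lemma phase_homo s t : s < t -> phase s < phase t.
Proof.
by move=> st; rewrite /phase ltr_pM2l ?ltrB2// ?divr_gt0 ?pi_gt0 ?subr_gt0// ltrD2r.
Qed.

Lemma continuous_phase : continuous phase.
Proof. by rewrite /phase; cont_tac. Qed.

(** The functions [q] for which [g * q] is orthogonal to all cosines are closed
    under linear combinations, and under multiplication by the first cosine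
    [c], by the product formula.  They contain the powers of
    [T = 1 + (e^2 - (c - c t0)^2) / 4], which peak at [t0] because [c] is
    injective; [peak_contradiction] applies to them. *)
Lemma cos_orth_pos g : continuous g ->
  (forall m, integ a b (fun t => g t * cos (m%:R * phase t)) = 0) ->
  forall t0, t0 \in `]a, b[ -> 0 < g t0 -> False.
Proof.
move=> cg orth t0 t0I g0.
have cphase := continuous_phase.
pose c t := cos (phase t).
have cc : continuous c by rewrite /c; cont_tac.
pose P q := continuous q /\
  forall m, integ a b (fun t => g t * q t * cos (m%:R * phase t)) = 0.
have cq_cos q m : continuous q ->
    continuous (fun t => g t * q t * cos (m%:R * phase t)) by move=> cq; cont_tac.
have cq_cosZ q m k : continuous q ->
    continuous (fun t => k * (g t * q t * cos (m%:R * phase t))).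
  by move=> cq; cont_tac.
have Pc q : P q -> P (fun t => c t * q t).
  move=> [cq Pq]; split; first by cont_tac.
  case=> [|m].
    have := Pq 1%N; congr (_ = _); apply: eq_integ => t _.
    by rewrite mul0r cos0 mul1r /c; ring.
  rewrite (_ : (fun t => _) = (fun t => 2^-1 * (g t * q t * cos (m.+2%:R * phase t)) +
       2^-1 * (g t * q t * cos (m%:R * phase t)))); last first.
    apply/funext => t.
    rewrite (_ : g t * _ * _ = g t * q t * (c t * cos (m.+1%:R * phase t))); last by ring.
    by rewrite /c cos_mul_succ; ring.
  rewrite integD; [|exact: cq_cosZ..].
  by rewrite !integZ; [rewrite !Pq !mulr0 addr0|exact: cq_cos..].
have PD q1 q2 : P q1 -> P q2 -> P (fun t => q1 t + q2 t).
  move=> [cq1 P1] [cq2 P2]; split; first by cont_tac.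
  move=> m; rewrite (_ : (fun t => _) = (fun t => g t * q1 t * cos (m%:R * phase t) +
       g t * q2 t * cos (m%:R * phase t))); last by apply/funext => t; ring.
  by rewrite integD; [rewrite P1 P2 addr0|exact: cq_cos..].
have PZ k q : P q -> P (fun t => k * q t).
  move=> [cq Pq]; split; first by cont_tac.
  move=> m; rewrite (_ : (fun t => _) =
    (fun t => k * (g t * q t * cos (m%:R * phase t)))); last by apply/funext => t; ring.
  by rewrite integZ; [rewrite Pq mulr0|exact: cq_cos].
(* a window around t0 on which g is bounded below *)
have [r [r0 ar rb gr]] : exists r, [/\ 0 < r, a <= t0 - r, t0 + r <= b &
    forall t, t \in `]t0 - r, t0 + r[ -> g t0 / 2 <= g t].
  have /cvgrPdist_le/(_ (g t0 / 2)) := cg t0; rewrite divr_gt0// => /(_ isT).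
  move=> /nbhs_ballP[r /= r0 H]; move: t0I; rewrite in_itv/= => /andP[at0 t0b].
  exists (Num.min r (Num.min (t0 - a) (b - t0))); split.
  - by rewrite !lt_min r0 !subr_gt0 at0.
  - have : Num.min r (Num.min (t0 - a) (b - t0)) <= t0 - a by rewrite !ge_min lexx orbT.
    lra.
  - have : Num.min r (Num.min (t0 - a) (b - t0)) <= b - t0 by rewrite !ge_min lexx !orbT.
    lra.
  - move=> t; rewrite in_itv/=.
    have : Num.min r (Num.min (t0 - a) (b - t0)) <= r by rewrite ge_min lexx.
    move=> h /andP[h1 h2].
    have /H : ball t0 r t by rewrite /ball/= ltr_norml; lra.
    by rewrite /= ler_norml => /andP[]; lra.
have cmono s t : s \in `[a, b] -> t \in `[a, b] -> s < t -> c t < c s.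
  by move=> sI tI st; rewrite /c ltr_cos ?phase_itv// phase_homo.
have inI t : t0 - r <= t -> t <= t0 + r -> t \in `[a, b].
  by move=> h1 h2; rewrite in_itv/=; lra.
(* outside the window [c] is at distance at least [e] from [c t0] *)
pose e := Num.min (c (t0 - r / 2) - c t0) (c t0 - c (t0 + r / 2)).
have e0 : 0 < e.
  by rewrite lt_min !subr_gt0 !cmono ?inI//; lra.
have eL : e <= c (t0 - r / 2) - c t0 by rewrite ge_min lexx.
have eR : e <= c t0 - c (t0 + r / 2) by rewrite ge_min lexx orbT.
pose T t := 1 + (e ^+ 2 - (c t - c t0) ^+ 2) / 4.
have cT : continuous T by rewrite /T; cont_tac.
have PT n : P (fun t => T t ^+ n).
  elim: n => [|n IH].
    split; first by cont_tac.
    by move=> m; rewrite -[RHS](orth m); congr integ; apply/funext => t; rewrite expr0 mulr1.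
  rewrite (_ : (fun t => _) = (fun t => (1 + (e ^+ 2 - c t0 ^+ 2) / 4) * T t ^+ n +
    ((c t0 / 2) * (c t * T t ^+ n) + (- 4^-1) * (c t * (c t * T t ^+ n))))); last first.
    by apply/funext => t; rewrite exprS {1}/T; field.
  exact: (PD _ _ (PZ _ _ IH)
    (PD _ _ (PZ _ _ (Pc _ IH)) (PZ _ _ (Pc _ (Pc _ IH))))).
have [r2 r20 Hr2] : exists2 r2, 0 < r2 & forall t, t \in `]t0 - r2, t0 + r2[ ->
  `|c t - c t0| <= e / 2.
  have /cvgrPdist_le/(_ (e / 2)) := cc t0; rewrite divr_gt0// => /(_ isT).
  move=> /nbhs_ballP[r2 /= r20 H]; exists r2 => // t; rewrite in_itv/= => h.
  by rewrite distrC; apply: H; rewrite /ball/= ltr_norml; lra.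
(* closer to [t0], where [|c - c t0| <= e / 2], one has [1 + e^2 / 16 <= T] *)
pose r3 := Num.min r r2.
have r3r : r3 <= r by rewrite ge_min lexx.
have r3r2 : r3 <= r2 by rewrite ge_min lexx orbT.
have r30 : 0 < r3 by rewrite lt_min r0.
pose k := Num.min (g t0 / 2) (e ^+ 2 / 16).
have k0 : 0 < k by rewrite lt_min !divr_gt0// exprn_gt0.
have kg : k <= g t0 / 2 by rewrite ge_min lexx.
have ke : k <= e ^+ 2 / 16 by rewrite ge_min lexx orbT.
apply: (@peak_contradiction a b g T t0 r3 k) => //; try lra.
- move=> t _; rewrite /T.
  have : (c t - c t0) ^+ 2 <= 2 ^+ 2.
    rewrite -[leLHS]real_normK ?num_real// lerXn2r ?nnegrE//.
    rewrite (le_trans (ler_normB _ _))// (_ : 2 = 1 + 1)// lerD// cos_max//.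
  have : 0 <= e ^+ 2 by rewrite sqr_ge0.
  lra.
- move=> t tI; have tcc : t \in `[a, b] by exact: subset_itv_oo_cc tI.
  have [h|h] := boolP (t \in `]t0 - r, t0 + r[).
    by apply/orP; right; apply: le_trans (gr t h); rewrite divr_ge0// ltW.
  apply/orP; left; rewrite /T.
  suff : e ^+ 2 <= (c t - c t0) ^+ 2 by lra.
  rewrite -[leRHS]real_normK ?num_real// lerXn2r ?nnegrE ?(ltW e0)//.
  move: h; rewrite in_itv/= negb_and -!leNgt => /orP[tl|tr].
    rewrite (le_trans eL)// (le_trans _ (ler_norm _))// lerD2r ltW//.
    by apply: cmono => //; [apply: inI; lra|lra].
  rewrite distrC (le_trans eR)// (le_trans _ (ler_norm _))// lerD2l lerN2 ltW//.
  by apply: cmono => //; [apply: inI; lra|lra].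
- move=> t; rewrite in_itv/= => h; split.
    by apply: (le_trans kg); apply: gr; rewrite in_itv/=; lra.
  have /Hr2 : t \in `]t0 - r2, t0 + r2[ by rewrite in_itv/=; lra.
  move=> ct; have : (c t - c t0) ^+ 2 <= (e / 2) ^+ 2.
    by rewrite -[leLHS]real_normK ?num_real// lerXn2r ?nnegrE// divr_ge0// ltW.
  rewrite /T expr_div_n; lra.
- move=> n; have [_ /(_ 0%N)] := PT n; congr (_ = _); congr integ.
  by apply/funext => t; rewrite mul0r cos0 mulr1.
Qed.

Lemma cos_complete g : continuous g ->
  (forall m, integ a b (fun t => g t * cos (m%:R * phase t)) = 0) ->
  {in `]a, b[, forall t, g t = 0}.
Proof.
move=> cg orth t tI; have cphase := continuous_phase;
  have [gneg|gpos|//] := ltgtP (g t) 0; last first.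
  by exfalso; exact: (cos_orth_pos cg orth tI).
exfalso; apply: (@cos_orth_pos (fun t => - g t) _ _ t) => //.
- by cont_tac.
- move=> m; rewrite (_ : (fun t => _) = (fun t => -1 * (g t * cos (m%:R * phase t)))).
    by rewrite integZ; [rewrite orth mulr0|cont_tac].
  by apply/funext => s; ring.
- by rewrite oppr_gt0.
Qed.

(** [g * sin] is orthogonal to all cosines, by the product formula. *)
Lemma sin_complete g : continuous g ->
  (forall m, integ a b (fun t => g t * sin (m.+1%:R * phase t)) = 0) ->
  {in `]a, b[, forall t, g t = 0}.
Proof.
move=> cg orth t tI; have cphase := continuous_phase.
have : g t * sin (phase t) = 0.
  apply: (@cos_complete (fun t => g t * sin (phase t))) tI => /=; first by cont_tac.
  case=> [|m].
    have := orth 0%N; congr (_ = _); congr integ; apply/funext => s.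
    by rewrite mul0r cos0 mul1r mulr1.
  rewrite (_ : (fun t => _) = (fun t => 2^-1 * (g t * sin (m.+2%:R * phase t)) -
       2^-1 * (g t * sin (m%:R * phase t)))); last first.
    apply/funext => s; rewrite -mulrA sin_mul_succ; ring.
  rewrite integB ?integZ; [|by cont_tac..].
  rewrite orth mulr0 sub0r; case: m => [|m]; last by rewrite orth mulr0 oppr0.
  rewrite (_ : (fun t => _) = fun=> 0) ?integ0 ?mulr0 ?oppr0//.
  by apply/funext => s; rewrite mul0r sin0 mulr0.
move=> /eqP; rewrite mulf_eq0 => /orP[/eqP//|]; rewrite gt_eqF//.
apply: sin_gt0_pi.
move: tI; rewrite in_itv/= => /andP[at_ tb].
have -> : 0 = phase a by rewrite /phase subrr mulr0.
have -> : pi = phase b by rewrite /phase /w divfK// subr_eq0 gt_eqF.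
by rewrite !phase_homo.
Qed.

End CosineCompleteness.

(** * Eigenfunctions of an interval *)

Section Modes1D.
Variable R : realType.
Implicit Types (bc : boundary_condition) (a b t : R) (m k : nat).

Definition bc_shift bc : nat := if bc is Dirichlet then 1%N else 0%N.

(** The eigenvalue at mode number 1 of the Neumann problem on [[a, b]]. *)
Definition fundamental a b : R := (pi / (b - a)) ^+ 2.

Definition mode bc a b m t : R :=
  match bc with
  | Dirichlet => sin (m.+1%:R * (pi / (b - a) * (t - a)))
  | Neumann => cos (m%:R * (pi / (b - a) * (t - a)))
  end.

Definition dmode bc a b m t : R :=
  match bc with
  | Dirichlet => m.+1%:R * (pi / (b - a)) * cos (m.+1%:R * (pi / (b - a) * (t - a)))
  | Neumann => - (m%:R * (pi / (b - a))) * sin (m%:R * (pi / (b - a) * (t - a)))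
  end.

Definition eigen1 bc a b m : R := mode_value (bc_shift bc) m (fundamental a b).

Lemma fundamental_gt0 a b : a < b -> 0 < fundamental a b.
Proof. by move=> ab; rewrite exprn_gt0// divr_gt0 ?pi_gt0 ?subr_gt0. Qed.

Lemma is_derive_sin_affine (c w a t : R) :
  is_derive t 1 (fun s => sin (c * (w * (s - a)))) (c * w * cos (c * (w * (t - a)))).
Proof.
have h : is_derive t 1 (fun s => c * (w * (s - a))) (c * w).
  by apply: is_derive_eq; rewrite /GRing.scale/=; ring.
have /= := @is_derive1_comp R sin (fun s => c * (w * (s - a))) t _ _ (is_derive_sin _) h.
by rewrite mulrC.
Qed.

Lemma is_derive_cos_affine (c w a t : R) :
  is_derive t 1 (fun s => cos (c * (w * (s - a)))) (- (c * w) * sin (c * (w * (t - a)))).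
Proof.
have h : is_derive t 1 (fun s => c * (w * (s - a))) (c * w).
  by apply: is_derive_eq; rewrite /GRing.scale/=; ring.
have /= := @is_derive1_comp R cos (fun s => c * (w * (s - a))) t _ _ (is_derive_cos _) h.
by rewrite mulrC mulrN mulNr.
Qed.

Lemma is_derive_mode bc a b m t : is_derive t 1 (mode bc a b m) (dmode bc a b m t).
Proof. by case: bc; [exact: is_derive_sin_affine|exact: is_derive_cos_affine]. Qed.

Lemma is_derive_dmode bc a b m t :
  is_derive t 1 (dmode bc a b m) (- eigen1 bc a b m * mode bc a b m t).
Proof.
case: bc; rewrite /mode/dmode/eigen1/mode_value/fundamental/=.
  set c := m.+1%:R * (pi / (b - a)); set x := m.+1%:R * _.
  rewrite (_ : - _ * _ = c * (- c * sin x)); last by rewrite addn1 /c; ring.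
  have h := is_derive_cos_affine m.+1%:R (pi / (b - a)) a t; exact: is_deriveZ.
set c := m%:R * (pi / (b - a)); set x := m%:R * _.
rewrite (_ : - _ * _ = - c * (c * cos x)); last by rewrite addn0 /c; ring.
have h := is_derive_sin_affine m%:R (pi / (b - a)) a t; exact: is_deriveZ.
Qed.

Lemma continuous_mode bc a b m : continuous (mode bc a b m).
Proof. exact: is_derive_continuous (is_derive_mode bc a b m). Qed.

Lemma continuous_dmode bc a b m : continuous (dmode bc a b m).
Proof. exact: is_derive_continuous (is_derive_dmode bc a b m). Qed.

Lemma sin_natpi n : sin (n%:R * pi) = 0 :> R.
Proof.
elim: n => [|n IH]; first by rewrite mul0r sin0.
by rewrite -natr1 mulrDl mul1r sinDpi IH oppr0.
Qed.

(** The boundary condition at an endpoint, in terms of the value and of the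
    derivative there. *)
Definition bc_at bc (v dv : R) : Prop :=
  if bc is Dirichlet then v = 0 else dv = 0.

Lemma mode_bc_lo bc a b m : bc_at bc (mode bc a b m a) (dmode bc a b m a).
Proof. by case: bc => /=; rewrite subrr !mulr0 sin0 ?mulr0. Qed.

Lemma mode_bc_hi bc a b m : a < b -> bc_at bc (mode bc a b m b) (dmode bc a b m b).
Proof.
move=> ab; have ba : b - a != 0 by rewrite subr_eq0 gt_eqF.
by case: bc => /=; rewrite divfK// sin_natpi ?mulr0.
Qed.

(** The function [g1 * mode - g * mode'] has the derivative
    [g2 * mode + eigenvalue * g * mode], and it vanishes at both endpoints, since
    [g] and [mode] satisfy the same boundary condition. *)
Lemma green bc a b m (g g1 g2 : R -> R) : a < b ->
  continuous g -> continuous g1 -> continuous g2 ->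
  {in `]a, b[, forall t : R, is_derive t 1 g (g1 t)} ->
  {in `]a, b[, forall t : R, is_derive t 1 g1 (g2 t)} ->
  bc_at bc (g a) (g1 a) -> bc_at bc (g b) (g1 b) ->
  integ a b (fun t => g2 t * mode bc a b m t) =
  - eigen1 bc a b m * integ a b (fun t => g t * mode bc a b m t).
Proof.
move=> ab cg cg1 cg2 dg dg1 bca bcb.
have cm := @continuous_mode bc a b m; have cdm := @continuous_dmode bc a b m.
pose W t := g1 t * mode bc a b m t - g t * dmode bc a b m t.
have cW : continuous W by rewrite /W; cont_tac.
have /(@integ_FTC _ a b W) : {in `]a, b[, forall t : R, is_derive t 1 W
    (g2 t * mode bc a b m t + eigen1 bc a b m * (g t * mode bc a b m t))}.
  move=> t tI.
  have h1 := dg t tI; have h2 := dg1 t tI.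
  have h3 := is_derive_mode bc a b m t; have h4 := is_derive_dmode bc a b m t.
  apply: is_derive_eq; rewrite /GRing.scale/=; ring.
rewrite integD ?integZ; [|by cont_tac..].
have W0 s : bc_at bc (g s) (g1 s) -> bc_at bc (mode bc a b m s) (dmode bc a b m s) -> W s = 0.
  by rewrite /W; case: (bc) => /= -> ->; rewrite mulr0 mul0r subr0.
rewrite (W0 _ bca (mode_bc_lo _ _ _ _)) (W0 _ bcb (mode_bc_hi _ _ ab)) subr0.
move=> H; apply/eqP; rewrite mulNr -addr_eq0 H//.
- exact: continuous_subspaceT.
- by cont_tac.
Qed.

Lemma eigen1_inj bc a b : a < b -> injective (eigen1 bc a b).
Proof.
move=> ab m k; rewrite /eigen1 /mode_value => /(mulIf (lt0r_neq0 (fundamental_gt0 ab))).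
move=> /eqP; rewrite eqrXn2// ?ler0n// eqr_nat eqn_add2r => /eqP//.
Qed.

Lemma mode_orth bc a b m k : a < b -> k != m ->
  integ a b (fun t => mode bc a b k t * mode bc a b m t) = 0.
Proof.
move=> ab km.
have cm j := @continuous_mode bc a b j.
have cg2 : continuous (fun t => - eigen1 bc a b k * mode bc a b k t).
  by have h := cm k; cont_tac.
have H := @green bc a b m _ _ _ ab (cm k) (@continuous_dmode bc a b k) cg2
  (fun t _ => is_derive_mode _ _ _ _ _) (fun t _ => is_derive_dmode _ _ _ _ _)
  (mode_bc_lo _ _ _ _) (mode_bc_hi _ _ ab).
rewrite (_ : (fun t => _) =
  (fun t => - eigen1 bc a b k * (mode bc a b k t * mode bc a b m t))) in H; last first.
  by apply/funext => t; rewrite mulrA.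
rewrite integZ in H; last by have h1 := cm k; have h2 := cm m; cont_tac.
move/eqP in H; apply/eqP.
move: H; rewrite -subr_eq0 -mulrBl mulf_eq0 => /orP[|//].
by rewrite subr_eq0 eqr_opp => /eqP /(eigen1_inj ab) /eqP; rewrite (negbTE km).
Qed.

Lemma mode_complete bc a b (g : R -> R) : a < b -> continuous g ->
  (forall m, integ a b (fun t => g t * mode bc a b m t) = 0) ->
  {in `]a, b[, forall t, g t = 0}.
Proof. by case: bc => ab cg; [exact: sin_complete|exact: cos_complete]. Qed.

(** Otherwise the mode would be orthogonal to all modes, hence zero by
    completeness; but at the point [t] of phase [pi / 4 * (m + e) / (m + 1)] it
    is positive. *)
Lemma mode_norm_neq0 bc a b m : a < b ->
  integ a b (fun t => mode bc a b m t * mode bc a b m t) != 0.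
Proof.
move=> ab; apply/eqP => n0.
have ba : 0 < b - a by rewrite subr_gt0.
have m4 : 0 < m.+1%:R :> R by rewrite ltr0n.
pose t := a + (b - a) / (4 * m.+1%:R).
have m1 : 1 <= m.+1%:R :> R by rewrite ler1n.
have q1 : 0 < (4 * m.+1%:R)^-1 :> R by rewrite invr_gt0 mulr_gt0.
have q2 : (4 * m.+1%:R)^-1 < 1 :> R by rewrite invf_lt1; lra.
have tI : t \in `]a, b[ by rewrite in_itv/= /t ltrDl mulr_gt0//= -ltrBrDl gtr_pMr.
have orth k : integ a b (fun t => mode bc a b m t * mode bc a b k t) = 0.
  by have [<-//|mk] := eqVneq m k; exact: mode_orth.
have := mode_complete ab (@continuous_mode bc a b m) orth tI.
apply/eqP.
have p4 : 0 < (pi : R) / 4 < pi / 2 by have := pi_gt0 R; lra.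
have eqt : pi / (b - a) * (t - a) = (pi / 4) / m.+1%:R.
  by rewrite /t; field; rewrite !gt_eqF.
rewrite gt_eqF// /mode; case: bc {n0 orth}; rewrite eqt.
  by rewrite mulrC divfK ?gt_eqF// sin_gt0_pihalf.
apply: cos_gt0_pihalf.
have -> : m%:R * (pi / 4 / m.+1%:R) = (pi / 4) * (m%:R / m.+1%:R) :> R by ring.
have x0 : 0 <= m%:R / m.+1%:R :> R by rewrite divr_ge0.
have x1 : m%:R / m.+1%:R <= 1 :> R by rewrite ler_pdivrMr// mul1r ler_nat.
move: p4 => /andP[p40 p42].
have y0 := mulr_ge0 (ltW p40) x0; have y1 := ler_piMr (ltW p40) x1.
move: (pi / 4 * (m%:R / m.+1%:R)) y0 y1 => z y0 y1.
by apply/andP; split; lra.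
Qed.

End Modes1D.

(** * Fourier coefficients on a box *)

Section CoordinateUpdate.
Variables (R : realType) (n : nat).
Implicit Types (x y : 'rV[R]_n) (i j : 'I_n) (s t : R).

Definition upd x i t : 'rV[R]_n := \row_j (if j == i then t else x 0 j).

Lemma updE x i t j : upd x i t 0 j = if j == i then t else x 0 j.
Proof. by rewrite mxE. Qed.

Lemma upd_id x i : upd x i (x 0 i) = x.
Proof. by apply/rowP => j; rewrite updE; case: eqP => // ->. Qed.

Lemma upd_comm x i j s t : i != j ->
  upd (upd x i s) j t = upd (upd x j t) i s.
Proof.
move=> ij; apply/rowP => k; rewrite !updE; have [->|//] := eqVneq k j.
by rewrite eq_sym (negbTE ij).
Qed.

Lemma continuous_rV (T : topologicalType) (F : T -> 'rV[R]_n) :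
  (forall j, continuous (fun z => F z 0 j)) -> continuous F.
Proof.
move=> cF z A [P /= nP PA].
have : \forall y \near z, forall (i : 'I_1) j, P i j (F y i j).
  apply: filter_forall => i; apply: filter_forall => j.
  by have := cF j z (P i j); rewrite (ord1 i); apply; exact: nP.
by apply: filterS => y Py; exact: PA.
Qed.

Lemma continuous_upd (T : topologicalType) (F : T -> 'rV[R]_n) (g : T -> R) i :
  continuous F -> continuous g -> continuous (fun z => upd (F z) i (g z)).
Proof.
move=> cF cg; apply: continuous_rV => j.
rewrite (_ : (fun z => _) = (fun z => if j == i then g z else F z 0 j)); last first.
  by apply/funext => z; rewrite updE.
case: (j == i) => // z.
apply: (@continuous_comp _ _ _ F (fun M => M 0 j)); first exact: cF.
exact: coord_continuous.
Qed.

Lemma continuous_updr x i : continuous (upd x i).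
Proof.
apply: (@continuous_upd _ (fun=> x) id); first exact: cst_continuous.
by move=> ?; exact: cvg_id.
Qed.

End CoordinateUpdate.

Section FourierCoefficients.
Variables (R : realType) (n : nat) (B : euclidean_box R n)
  (bc : boundary_condition).
Implicit Types (x y : 'rV[R]_n) (i j : 'I_n) (f g : 'rV[R]_n -> R).
Implicit Types (m k : 'I_n -> nat) (s : seq 'I_n).
Let lo i := box_lo B 0 i.
Let hi i := box_hi B 0 i.
Let lohi i : lo i < hi i := box_lo_lt_hi B i.

Definition coord_mode i (p : nat) (t : R) : R := mode bc (lo i) (hi i) p t.

Lemma continuous_coord_mode i p : continuous (coord_mode i p).
Proof. exact: continuous_mode. Qed.

(** Fourier coefficient in the [i]-th coordinate alone, as a function on the
    whole space that does not depend on that coordinate.  Keeping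
    the dimension of the space fixed spares the restriction to faces. *)
Definition partial_coef i (p : nat) f x : R :=
  integ (lo i) (hi i) (fun t => f (upd x i t) * coord_mode i p t).

Lemma upd_in_box x i t : box_set B x -> t \in `]lo i, hi i[ ->
  box_set B (upd x i t).
Proof. by move=> Bx tI j; rewrite updE; case: eqP => [->|_]; [|exact: Bx]. Qed.

Lemma continuous_slice f x i : continuous f -> continuous (fun t => f (upd x i t)).
Proof.
by move=> cf t; apply: continuous_comp; [exact: continuous_updr|exact: cf].
Qed.

Lemma continuous_partial_coef i p f : continuous f ->
  continuous (partial_coef i p f).
Proof.
move=> cf; apply: (@continuous_integ_param R _
  (fun x t => f (upd x i t) * coord_mode i p t)); first exact: lohi.
apply: continuous_fun_mul.
  move=> z; apply: continuous_comp; last exact: cf.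
  apply: (@continuous_upd _ _ _ fst snd) => {}z; [exact: cvg_fst|exact: cvg_snd].
move=> z; apply: continuous_comp; first exact: cvg_snd.
exact: continuous_coord_mode.
Qed.

Lemma eq_partial_coef i p f g x : box_set B x ->
  (forall y, box_set B y -> f y = g y) ->
  partial_coef i p f x = partial_coef i p g x.
Proof. by move=> Bx fg; apply: eq_integ => t tI; rewrite fg//; exact: upd_in_box. Qed.

Lemma partial_coefD i p f g x : continuous f -> continuous g ->
  partial_coef i p (fun y => f y + g y) x =
  partial_coef i p f x + partial_coef i p g x.
Proof.
move=> cf cg; rewrite /partial_coef -integD.
- by congr integ; apply/funext => t; rewrite mulrDl.
- by apply: continuous_fun_mul; [exact: continuous_slice|exact: continuous_coord_mode].
- by apply: continuous_fun_mul; [exact: continuous_slice|exact: continuous_coord_mode].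
Qed.

Lemma partial_coefZ i p c f x : continuous f ->
  partial_coef i p (fun y => c * f y) x = c * partial_coef i p f x.
Proof.
move=> cf; rewrite /partial_coef -integZ.
  by congr integ; apply/funext => t; rewrite mulrA.
by apply: continuous_fun_mul; [exact: continuous_slice|exact: continuous_coord_mode].
Qed.

(** Fubini's theorem for the [i]-th and the [j]-th coordinate. *)
Lemma partial_coef_swap i j p q f x : i != j -> continuous f ->
  partial_coef i p (partial_coef j q f) x =
  partial_coef j q (partial_coef i p f) x.
Proof.
move=> ij cf; rewrite /partial_coef.
pose h (s t : R) := f (upd (upd x i s) j t) * coord_mode j q t * coord_mode i p s.
have ch : continuous (fun z : R * R => h z.1 z.2).
  rewrite /h; do 2 ?apply: continuous_fun_mul.
  - move=> z; apply: continuous_comp; last exact: cf.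
    apply: (@continuous_upd _ _ _ (fun z : R * R => upd x i z.1) snd) => {z}.
      move=> z; apply: continuous_comp; first exact: cvg_fst.
      exact: continuous_updr.
    by move=> z; exact: cvg_snd.
  - move=> z; apply: continuous_comp; first exact: cvg_snd.
    exact: continuous_coord_mode.
  - move=> z; apply: continuous_comp; first exact: cvg_fst.
    exact: continuous_coord_mode.
have := integ_swap (lohi i) (lohi j) ch.
congr (_ = _); congr integ; apply/funext => s; rewrite mulrC -integZ.
- by congr integ; apply/funext => t; rewrite /h mulrC.
- by apply: continuous_fun_mul; [exact: continuous_slice|exact: continuous_coord_mode].
- by congr integ; apply/funext => t; rewrite /h upd_comm//; ring.
- by apply: continuous_fun_mul; [exact: continuous_slice|exact: continuous_coord_mode].
Qed.

Definition iter_coef m s f : 'rV[R]_n -> R :=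
  foldr (fun i g => partial_coef i (m i) g) f s.

Lemma iter_coef_cons m i s f :
  iter_coef m (i :: s) f = partial_coef i (m i) (iter_coef m s f).
Proof. by []. Qed.

(** A constant function ([coef_cst]): all coordinates are integrated out. *)
Definition coef m f : 'rV[R]_n -> R := iter_coef m (enum 'I_n) f.

Lemma continuous_iter_coef m s f : continuous f -> continuous (iter_coef m s f).
Proof. by move=> cf; elim: s => //= i s IH; exact: continuous_partial_coef. Qed.

Lemma eq_iter_coef m s f g x : box_set B x ->
  (forall y, box_set B y -> f y = g y) -> iter_coef m s f x = iter_coef m s g x.
Proof.
move=> Bx fg; elim: s x Bx => [|i s IH] x Bx /=; first exact: fg.
exact: eq_partial_coef.
Qed.

Lemma iter_coefD m s f g x : continuous f -> continuous g ->
  iter_coef m s (fun y => f y + g y) x = iter_coef m s f x + iter_coef m s g x.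
Proof.
move=> cf cg; elim: s x => //= i s IH x.
rewrite -partial_coefD; [|exact: continuous_iter_coef..].
by congr partial_coef; apply/funext.
Qed.

Lemma iter_coefZ m s c f x : continuous f ->
  iter_coef m s (fun y => c * f y) x = c * iter_coef m s f x.
Proof.
move=> cf; elim: s x => //= i s IH x.
rewrite -partial_coefZ; last exact: continuous_iter_coef.
by congr partial_coef; apply/funext.
Qed.

Lemma iter_coef0 m s x : iter_coef m s (fun=> 0) x = 0.
Proof.
have c0 : continuous ((fun=> 0) : 'rV[R]_n -> R) by exact: cst_continuous.
have := iter_coefZ m s 0 x c0.
by under eq_fun do rewrite mul0r; rewrite mul0r.
Qed.

Lemma iter_coef_sum m s (I : Type) (r : seq I) (F : I -> 'rV[R]_n -> R) x :
  (forall a : I, continuous (F a)) ->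
  iter_coef m s (fun y => \sum_(a <- r) F a y) x =
  \sum_(a <- r) iter_coef m s (F a) x.
Proof.
move=> cF; elim: r => [|a r IH].
  rewrite big_nil -[RHS](iter_coef0 m s x); congr iter_coef.
  by apply/funext => y; rewrite big_nil.
rewrite big_cons -IH -iter_coefD//; last exact: continuous_fun_sum.
by congr iter_coef; apply/funext => y; rewrite big_cons.
Qed.

Lemma iter_coef_innermost m s i f : i \notin s -> continuous f ->
  partial_coef i (m i) (iter_coef m s f) = iter_coef m s (partial_coef i (m i) f).
Proof.
move=> + cf; elim: s => //= j s IH; rewrite inE negb_or => /andP[ij is_].
rewrite -IH//; apply/funext => x; rewrite partial_coef_swap//.
exact: continuous_iter_coef.
Qed.

(** Any coordinate can be integrated first, that is, where the function still
    is [f] itself and Green's identity is available. *)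
Lemma coef_innermost m i : exists s, forall f, continuous f ->
  coef m f = iter_coef m s (partial_coef i (m i) f).
Proof.
rewrite /coef.
have : i \in enum 'I_n by rewrite mem_enum.
have := enum_uniq 'I_n; move: (enum 'I_n) => r + ir.
case/splitPr: ir => p q; rewrite cat_uniq /= negb_or => /and3P[_ _ /andP[iq _]].
exists (p ++ q) => f cf.
by rewrite /iter_coef !foldr_cat/= -/(iter_coef m q f) iter_coef_innermost.
Qed.

Lemma eq_iter_coef_index m k s f : (forall i, i \in s -> m i = k i) ->
  iter_coef m s f = iter_coef k s f.
Proof.
elim: s => [//|i s IH] mk; rewrite !iter_coef_cons (mk i (mem_head i s)) IH//.
by move=> j js; apply: mk; rewrite inE js orbT.
Qed.

(** Induction on [s]: for fixed other mode numbers, completeness of the modes of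
    the outermost coordinate makes the remaining iterated coefficient vanish. *)
Lemma iter_coef_complete s f : uniq s -> continuous f ->
  (forall m x, box_set B x -> iter_coef m s f x = 0) ->
  forall x, box_set B x -> f x = 0.
Proof.
move=> + cf; elim: s => [|i s IH].
  by move=> _ H x Bx; exact: (H (fun=> 0%N) x Bx).
rewrite cons_uniq => /andP[is_ us] H; apply: IH => // m x Bx.
have cg := @continuous_iter_coef m s f cf.
have := @mode_complete R bc (lo i) (hi i) (fun t => iter_coef m s f (upd x i t))
  (lohi i) (@continuous_slice _ x i cg) _ (x 0 i) (Bx i).
rewrite upd_id; apply => p.
(* the mode number of [i] can be varied alone, as [i] is not in [s] *)
pose m' j := if j == i then p else m j.
have m'i : m' i = p by rewrite /m' eqxx.
have <- : iter_coef m' s f = iter_coef m s f.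
  apply: eq_iter_coef_index => j js; rewrite /m'.
  by case: eqP => // ji; rewrite -ji js in is_.
by have := H m' x Bx; rewrite iter_coef_cons m'i.
Qed.

Lemma coef_complete f : continuous f ->
  (forall m x, box_set B x -> coef m f x = 0) ->
  forall x, box_set B x -> f x = 0.
Proof. by apply: iter_coef_complete; exact: enum_uniq. Qed.

Definition box_mode k x : R := \prod_(i < n) coord_mode i (k i) (x 0 i).

Definition mode_dot i (p q : nat) : R :=
  integ (lo i) (hi i) (fun t => coord_mode i p t * coord_mode i q t).

Lemma iter_coef_box_mode m k s x : uniq s ->
  iter_coef m s (box_mode k) x =
  \prod_(i <- s) mode_dot i (k i) (m i) *
  \prod_(i < n | i \notin s) coord_mode i (k i) (x 0 i).
Proof.
elim: s x => [|i s IH] x.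
  by rewrite big_nil mul1r.
rewrite cons_uniq => /andP[is_ us]; rewrite iter_coef_cons /partial_coef.
set P := \prod_(j < n | j \notin i :: s) coord_mode j (k j) (x 0 j).
rewrite (_ : (fun t => _) = (fun t => (\prod_(j <- s) mode_dot j (k j) (m j) * P) *
    (coord_mode i (k i) t * coord_mode i (m i) t))); last first.
  apply/funext => t; rewrite IH// (bigD1 i is_)/= updE eqxx.
  rewrite (_ : \prod_(j < n | _) _ = P); first by ring.
  rewrite /P; apply: eq_big => [j|j /andP[_ ji]].
    by rewrite inE negb_or andbC.
  by rewrite updE (negbTE ji).
rewrite integZ; last first.
  by apply: continuous_fun_mul; exact: continuous_coord_mode.
by rewrite big_cons -/(mode_dot i (k i) (m i)); ring.
Qed.

Lemma coef_box_mode m k x :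
  coef m (box_mode k) x = \prod_(i < n) mode_dot i (k i) (m i).
Proof.
rewrite /coef iter_coef_box_mode ?enum_uniq// [X in _ * X]big_pred0 ?mulr1.
  by rewrite big_enum.
by move=> i; rewrite mem_enum.
Qed.

Lemma continuous_box_mode k : continuous (box_mode k).
Proof.
apply: (@continuous_fun_prod _ _ _ _ _ (fun i (x : 'rV[R]_n) =>
  coord_mode i (k i) (x 0 i))) => i x.
apply: continuous_comp; first exact: coord_continuous.
exact: continuous_coord_mode.
Qed.

Lemma coef_box_mode_neq m k x i : k i != m i -> coef m (box_mode k) x = 0.
Proof.
move=> km; rewrite coef_box_mode (bigD1 i)//= /mode_dot mode_orth ?mul0r//.
Qed.

Lemma coef_box_mode_neq0 m x : coef m (box_mode m) x != 0.
Proof.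
by rewrite coef_box_mode; apply/prodf_neq0 => i _; exact: mode_norm_neq0.
Qed.

End FourierCoefficients.

(** * The closed box and slices *)

Section BoxGeometry.
Variables (R : realType) (n : nat) (B : euclidean_box R n).
Implicit Types (x y : 'rV[R]_n) (i j : 'I_n).
Notation lo i := (box_lo B 0 i).
Notation hi i := (box_hi B 0 i).

Definition closed_box : set 'rV[R]_n := [set x | forall i, x 0 i \in `[lo i, hi i]].

Definition box_center : 'rV[R]_n := \row_i ((lo i + hi i) / 2).

Lemma box_center_in : box_set B box_center.
Proof.
by move=> i; rewrite mxE in_itv/=; have := box_lo_lt_hi B i => ?; apply/andP; split; lra.
Qed.

(** A point of the closed box is the limit of the points of the segment from it
    to the center. *)
Lemma closed_box_closure : closed_box `<=` closure (box_set B).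
Proof.
move=> x cx U nU.
pose y (s : R) := \row_i (x 0 i + s * (box_center 0 i - x 0 i)) : 'rV[R]_n.
have cy : continuous y.
  apply: continuous_rV => j.
  rewrite (_ : (fun z => _) = (fun s => x 0 j + s * (box_center 0 j - x 0 j))).
    by cont_tac.
  by apply/funext => s; rewrite mxE.
have y0 : y 0 = x by apply/rowP => j; rewrite mxE mul0r addr0.
have yB s : 0 < s -> s < 1 -> box_set B (y s).
  move=> s0 s1 i; have := cx i; have := box_center_in i; rewrite !in_itv/= [y s 0 i]mxE.
  move: (box_center 0 i) (x 0 i) (lo i) (hi i) => c z l h /andP[lc ch] /andP[lz zh].
  by apply/andP; split; nra.
have : nbhs (0 : R) (y @^-1` U) by apply: cy; rewrite y0.
move=> /nbhs_ballP[e /= e0 eU].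
pose s : R := Num.min (e / 2) (1 / 2).
have s0 : 0 < s by rewrite lt_min !divr_gt0.
have se : s < e.
  apply: (@le_lt_trans _ _ (e / 2)); [by rewrite ge_min lexx | lra].
have s1 : s < 1.
  apply: (@le_lt_trans _ _ (1 / 2)); [by rewrite ge_min lexx orbT | lra].
exists (y s); split; first exact: yB.
by apply: eU; rewrite /ball/= sub0r normrN gtr0_norm.
Qed.

Lemma closure_closed_box : closure (box_set B) `<=` closed_box.
Proof.
move=> x clx i; rewrite in_itv/=; apply/negPn/negP; rewrite negb_and -!ltNge => out.
have ci : continuous (fun z : 'rV[R]_n => z 0 i) := @coord_continuous R 1 n 0 i.
have [z [Bz]] : exists z, box_set B z /\ (z 0 i < lo i) || (hi i < z 0 i).
  have [|z [Bz zU]]   := clx [set z : 'rV[R]_n | (z 0 i < lo i) || (hi i < z 0 i)].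
    case/orP: out => h.
      have : nbhs x [set z : 'rV[R]_n | z 0 i < lo i] by exact: (ci x _ (lt_nbhsl h)).
      by apply: filterS => z /= ->.
    have : nbhs x [set z : 'rV[R]_n | hi i < z 0 i] by exact: (ci x _ (lt_nbhsr h)).
    by apply: filterS => z /= ->; rewrite orbT.
  by exists z.
have := Bz i; rewrite in_itv/= => /andP[h1 h2].
by rewrite !ltNge (ltW h1) (ltW h2).
Qed.

Lemma box_set_closed_box : box_set B `<=` closed_box.
Proof. by move=> x Bx i; exact: subset_itv_oo_cc (Bx i). Qed.

(** The projection onto the closed box.  Composing with it turns a function
    that is continuous on the closed box into one that is continuous
    everywhere, with the same values on the box. *)
Definition clamp x : 'rV[R]_n := \row_i Num.max (lo i) (Num.min (hi i) (x 0 i)).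

Lemma continuous_clamp : continuous clamp.
Proof.
apply: continuous_rV => j.
rewrite (_ : (fun z => _) = (fun z : 'rV[R]_n => Num.max (lo j) (Num.min (hi j) (z 0 j)))).
  move=> z; apply: (@continuous_comp _ _ _ (fun z : 'rV[R]_n => z 0 j)
    (fun t : R => Num.max (lo j) (Num.min (hi j) t))).
    exact: coord_continuous.
  apply: continuous_max; first exact: cst_continuous.
  by apply: continuous_min; [exact: cst_continuous|exact: cvg_id].
by apply/funext => z; rewrite mxE.
Qed.

Lemma clamp_closed x : closed_box (clamp x).
Proof.
move=> i; rewrite mxE in_itv/= le_max lexx/= ge_max ge_min lexx orTb.
by rewrite ltW// box_lo_lt_hi.
Qed.

Lemma clamp_id x : closed_box x -> clamp x = x.
Proof.
move=> cx; apply/rowP => i; rewrite mxE.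
have := cx i; rewrite in_itv/= => /andP[h1 h2].
by rewrite (min_idPr h2) (max_idPr h1).
Qed.

Lemma continuous_clamped (g : 'rV[R]_n -> R) :
  {within closure (box_set B), continuous g} -> continuous (g \o clamp).
Proof.
move=> /subspace_continuousP cg x W nW.
have cx : closure (box_set B) (clamp x) by exact/closed_box_closure/clamp_closed.
have H : nbhs x (clamp @^-1` [set y | closure (box_set B) y -> W (g y)]) :=
  continuous_clamp (cg _ cx _ nW).
change (nbhs x ((g \o clamp) @^-1` W)); apply: filterS H => y; apply.
exact/closed_box_closure/clamp_closed.
Qed.

Lemma upd_in_closed_box x i t : closed_box x -> t \in `[lo i, hi i] ->
  closed_box (upd x i t).
Proof. by move=> cx tI j; rewrite updE; case: eqP => [->|_]; [|exact: cx]. Qed.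

End BoxGeometry.

Section Slices.
Variables (R : realType) (n : nat).
Implicit Types (u : 'rV[R]_n -> R) (x : 'rV[R]_n) (i : 'I_n).

Lemma upd_basis_vec x i (t h : R) :
  h *: basis_vec R i + upd x i t = upd x i (h + t).
Proof.
apply/rowP => j; rewrite !mxE eqxx/=; case: (j == i); first by rewrite mulr1.
by rewrite mulr0 add0r.
Qed.

Lemma is_derive_slice u x i (t d : R) :
  is_derive (upd x i t) (basis_vec R i) u d <->
  is_derive t 1 (fun s => u (upd x i s)) d.
Proof.
have E : (fun h : R => h^-1 *: ((u \o shift (upd x i t)) (h *: basis_vec R i) -
      u (upd x i t))) =
    (fun h : R => h^-1 *: (((fun s => u (upd x i s)) \o shift t) (h *: 1) - u (upd x i t))).
  by apply/funext => h /=; rewrite upd_basis_vec /GRing.scale/= mulr1.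
split=> -[h1 h2]; apply: DeriveDef; rewrite /derivable /derive.
- by rewrite -E; exact: h1.
- by rewrite -E; exact: h2.
- by rewrite E; exact: h1.
- by rewrite E; exact: h2.
Qed.

Lemma is_derive_basis_vec u x i (d : R) :
  is_derive x (basis_vec R i) u d <->
  is_derive (x 0 i) 1 (fun s => u (upd x i s)) d.
Proof. by rewrite -is_derive_slice upd_id. Qed.

(** The derivative along [- basis_vec R i] is that of the slice traversed
    backwards.  Only derivatives along the axes are at hand, so linearity of the
    derivative in the direction cannot be used. *)
Lemma derive_opp_basis_vec u x i : derivable u x (basis_vec R i) ->
  'D_(- basis_vec R i) u x = - partial_deriv i u x.
Proof.
move=> dux; have /is_derive_basis_vec du : is_derive x (basis_vec R i) u (partial_deriv i u x).
  exact: DeriveDef.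
have : is_derive (- x 0 i) 1 ((fun s => u (upd x i s)) \o -%R) (- partial_deriv i u x).
  have du' : is_derive (- - x 0 i) 1 (fun s => u (upd x i s)) (partial_deriv i u x).
    by rewrite opprK.
  have := @is_derive1_comp R (fun s => u (upd x i s)) -%R (- x 0 i) _ _ du' _.
  by move=> /(_ _ (is_deriveNid (- x 0 i) 1)); rewrite mulrN1.
move=> [_ <-]; rewrite /derive.
have -> // : (fun h : R => h^-1 *: ((u \o shift x) (h *: - basis_vec R i) - u x)) =
  (fun h : R => h^-1 *: ((((fun s => u (upd x i s)) \o -%R) \o shift (- x 0 i)) (h *: 1) -
     ((fun s => u (upd x i s)) \o -%R) (- x 0 i))).
apply/funext => h /=.
rewrite opprK upd_id /GRing.scale/= mulr1; congr (_ * (u _ - _)).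
apply/rowP => j; rewrite !mxE eqxx/=; case: eqP => [->|_]; last by rewrite oppr0 mulr0 add0r.
by rewrite opprD opprK mulrN mulr1.
Qed.

End Slices.

(** * Fourier coefficients of eigenfunctions *)

Section EigenfunctionCoefficients.
Variables (R : realType) (n : nat) (B : euclidean_box R n)
  (bc : boundary_condition) (l : R).
Implicit Types (u : 'rV[R]_n -> R) (x y : 'rV[R]_n) (i j : 'I_n).
Notation lo i := (box_lo B 0 i).
Notation hi i := (box_hi B 0 i).

(** A function that agrees with [v] on the box has the same slices as [v] near
    every interior point. *)
Lemma is_derive_slice_eq_on_box (v g : 'rV[R]_n -> R) i x (t : R) :
  box_set B x -> t \in `]lo i, hi i[ ->
  (forall y, box_set B y -> derivable v y (basis_vec R i)) ->
  (forall y, box_set B y -> g y = v y) ->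
  is_derive t 1 (fun s => g (upd x i s)) (partial_deriv i v (upd x i t)).
Proof.
move=> Bx tI dv gv.
have : is_derive t 1 (fun s => v (upd x i s)) (partial_deriv i v (upd x i t)).
  by apply/is_derive_slice; apply: DeriveDef => //; apply: dv; exact: upd_in_box.
apply: near_eq_is_derive; have := near_in_itvoo tI; apply: filterS => s sI.
by rewrite gv//; exact: upd_in_box.
Qed.

(** At a point of a facet both the continuous extension [g1] of the partial
    derivative and the Neumann condition give the limit of the normal derivative
    from inside the box. *)
Lemma neumann_normal_derivative_eq0 u (g1 : 'rV[R]_n -> R) i x (b : bool) :
  satisfies_bc Neumann B u ->
  (forall y, box_set B y -> derivable u y (basis_vec R i)) ->
  continuous g1 -> (forall y, box_set B y -> g1 y = partial_deriv i u y) ->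
  box_set B x -> g1 (upd x i (if b then hi i else lo i)) = 0.
Proof.
move=> bcu du cg1 g1E Bx; set y := upd x i _.
have tI : (if b then hi i else lo i) \in `[lo i, hi i].
  by have := ltW (box_lo_lt_hi B i); case: b {y} => h; rewrite in_itv/= lexx ?andbT h.
have cy : closed_box B y by apply: upd_in_closed_box => //; exact: box_set_closed_box.
have clA : closure (box_set B) y by exact: closed_box_closure.
have PF : ProperFilter (within (box_set B) (nbhs y)) by exact: within_nbhs_proper.
have cvg1 : g1 z @[z --> within (box_set B) (nbhs y)] --> g1 y.
  by apply: cvg_trans (cg1 y); apply: cvg_app; exact: cvg_within.
pose v := if b then basis_vec R i else - basis_vec R i.
have normal : outward_normal B y v.
  exists i; split.
    by rewrite /y /v !updE eqxx; case: (b); [left|right].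
  by move=> j ji; rewrite /y updE (negbTE ji); exact: Bx.
have /= cvg2 := bcu y v normal.
have cvg3 : (if b then g1 z else - g1 z) @[z --> within (box_set B) (nbhs y)] --> (0 : R).
  apply: cvg_trans cvg2; apply: near_eq_cvg; rewrite near_withinE; apply: nearW => z Bz.
  rewrite /v; case: (b); rewrite g1E//.
  by rewrite derive_opp_basis_vec//; exact: du.
have : (if b then g1 y else - g1 y) = 0.
  apply: (cvg_unique _ _ cvg3) => //; case: (b) => //; exact: cvgN.
by case: (b) => // /eqP; rewrite oppr_eq0 => /eqP.
Qed.

Lemma dirichlet_clamped_eq0 u i x (b : bool) : satisfies_bc Dirichlet B u ->
  box_set B x -> (u \o clamp B) (upd x i (if b then hi i else lo i)) = 0.
Proof.
move=> bcu Bx; set y := upd x i _.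
have tI : (if b then hi i else lo i) \in `[lo i, hi i].
  by have := ltW (box_lo_lt_hi B i); case: b {y} => h; rewrite in_itv/= lexx ?andbT h.
have cy : closed_box B y by apply: upd_in_closed_box => //; exact: box_set_closed_box.
rewrite /= clamp_id//; apply: bcu; split; first exact: closed_box_closure.
move=> /(_ i); rewrite /y updE eqxx in_itv/=.
by case: (b); rewrite ltxx ?andbF.
Qed.

(** Green's identity on the slices of [u] in direction [i]; [g2] is the
    continuous extension of the second derivative, and the boundary condition of
    [u] provides that of the slices at their two endpoints. *)
Lemma partial_coef_second_derivative u i : Defs.eigenspace bc B l u ->
  exists g2 : 'rV[R]_n -> R, [/\ continuous g2,
    forall x, box_set B x -> g2 x = partial_deriv i (partial_deriv i u) x &
    forall p x, box_set B x -> partial_coef B bc i p g2 x =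
      - eigen1 bc (lo i) (hi i) p * partial_coef B bc i p (u \o clamp B) x].
Proof.
move=> [[cu du du1 ddu du2] _ bcu].
have [g1' [cg1' g1'E]] := du1 i; have [g2' [cg2' g2'E]] := du2 i i.
have inc x : box_set B x -> clamp B x = x.
  by move=> Bx; apply: clamp_id; exact: box_set_closed_box.
pose g1 := g1' \o clamp B; pose g2 := g2' \o clamp B.
have cg1 : continuous g1 by exact: continuous_clamped.
have cg2 : continuous g2 by exact: continuous_clamped.
have cu' : continuous (u \o clamp B) by exact: continuous_clamped.
have g1E x : box_set B x -> g1 x = partial_deriv i u x.
  by move=> Bx; rewrite /g1/= inc// g1'E.
have g2E x : box_set B x -> g2 x = partial_deriv i (partial_deriv i u) x.
  by move=> Bx; rewrite /g2/= inc// g2'E.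
exists g2; split => // p x Bx.
apply: (@green R bc (lo i) (hi i) p (fun t => (u \o clamp B) (upd x i t))
  (fun t => g1 (upd x i t))).
- exact: box_lo_lt_hi.
- exact: continuous_slice.
- exact: continuous_slice.
- exact: continuous_slice.
- move=> t tI; rewrite g1E; last exact: upd_in_box.
  apply: is_derive_slice_eq_on_box => // y By /=; first exact: du.
  by rewrite inc.
- move=> t tI; rewrite g2E; last exact: upd_in_box.
  by apply: is_derive_slice_eq_on_box => // y By; exact: ddu.
- case E : bc => /=; rewrite E in bcu.
    exact: (@dirichlet_clamped_eq0 u i x false).
  exact: (@neumann_normal_derivative_eq0 u g1 i x false bcu (du i)).
- case E : bc => /=; rewrite E in bcu.
    exact: (@dirichlet_clamped_eq0 u i x true).
  exact: (@neumann_normal_derivative_eq0 u g1 i x true bcu (du i)).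
Qed.

(** Integrating [laplace u = l * u] against the product of the modes [m]. *)
Lemma coef_eigenfunction u (m : 'I_n -> nat) x : Defs.eigenspace bc B l u ->
  box_set B x ->
  (\sum_(i < n) eigen1 bc (lo i) (hi i) (m i)) * coef B bc m (u \o clamp B) x =
  l * coef B bc m (u \o clamp B) x.
Proof.
move=> eu Bx.
have [G HG] := choice (fun i => partial_coef_second_derivative i eu).
have [[cu _ _ _ _] lapu _] := eu.
have cu' : continuous (u \o clamp B) by exact: continuous_clamped.
have cG i : continuous (G i) by have [] := HG i.
have coefG i : coef B bc m (G i) x =
    - eigen1 bc (lo i) (hi i) (m i) * coef B bc m (u \o clamp B) x.
  have [_ _ GE] := HG i.
  have [s Es] := coef_innermost B bc m i.
  rewrite (Es _ (cG i)) (Es _ cu').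
  rewrite -iter_coefZ; last exact: continuous_partial_coef.
  by apply: eq_iter_coef => // y By; exact: GE.
have : coef B bc m (fun y => \sum_(i < n) G i y) x =
       coef B bc m (fun y => - l * (u \o clamp B) y) x.
  apply: eq_iter_coef => // y By /=.
  rewrite clamp_id; last exact: box_set_closed_box.
  rewrite mulNr -lapu// opprK; apply: eq_bigr => i _.
  by have [_ GE _] := HG i; rewrite GE.
rewrite [X in X = _ -> _](_ : _ = \sum_(i < n) coef B bc m (G i) x); last first.
  exact: iter_coef_sum.
rewrite (eq_bigr _ (fun i _ => coefG i)).
rewrite [X in _ = X -> _](_ : _ = - l * coef B bc m (u \o clamp B) x); last first.
  exact: iter_coefZ.
by rewrite -mulr_suml sumrN !mulNr => /oppr_inj.
Qed.

End EigenfunctionCoefficients.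

(** * Box modes are eigenfunctions *)

Section BoxModesAreEigenfunctions.
Variables (R : realType) (n : nat) (B : euclidean_box R n)
  (bc : boundary_condition).
Implicit Types (x y : 'rV[R]_n) (i j : 'I_n) (k : 'I_n -> nat) (o : 'I_n -> nat).
Notation lo i := (box_lo B 0 i).
Notation hi i := (box_hi B 0 i).

(** The [r]-th derivative of [mode], where the second derivative is expressed
    through the eigenvalue.  It serves all the partial derivatives of [box_mode]
    at once: each is a product of the same shape. *)
Fixpoint mode_deriv (a b : R) (p r : nat) : R -> R :=
  match r with
  | 0 => mode bc a b p
  | 1 => dmode bc a b p
  | r'.+2 => fun t => - eigen1 bc a b p * mode_deriv a b p r' t
  end.

Lemma is_derive_mode_deriv (a b : R) p r (t : R) :
  is_derive t 1 (mode_deriv a b p r) (mode_deriv a b p r.+1 t).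
Proof.
suff [//] : is_derive t 1 (mode_deriv a b p r) (mode_deriv a b p r.+1 t) /\
  is_derive t 1 (mode_deriv a b p r.+1) (mode_deriv a b p r.+2 t).
elim: r => [|r [IH1 IH2]]; first by split; [exact: is_derive_mode|exact: is_derive_dmode].
by split=> //; exact: is_deriveZ.
Qed.

(** The mixed partial derivative of [box_mode] of order [o i] in the [i]-th
    coordinate. *)
Definition box_mode_deriv k o x : R :=
  \prod_(i < n) mode_deriv (lo i) (hi i) (k i) (o i) (x 0 i).

Definition incr_order o i : 'I_n -> nat := fun j => if j == i then (o j).+1 else o j.

Lemma is_derive_box_mode_deriv k o i x :
  is_derive x (basis_vec R i) (box_mode_deriv k o)
    (box_mode_deriv k (incr_order o i) x).
Proof.
apply/is_derive_basis_vec.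
pose C := \prod_(j < n | j != i) mode_deriv (lo j) (hi j) (k j) (o j) (x 0 j).
have -> : (fun s => box_mode_deriv k o (upd x i s)) =
    (fun s => C * mode_deriv (lo i) (hi i) (k i) (o i) s).
  apply/funext => s; rewrite /box_mode_deriv (bigD1 i)//= updE eqxx mulrC.
  by congr (_ * _); apply: eq_bigr => j ji; rewrite updE (negbTE ji).
have -> : box_mode_deriv k (incr_order o i) x =
    C * mode_deriv (lo i) (hi i) (k i) (o i).+1 (x 0 i).
  rewrite /box_mode_deriv (bigD1 i)//= /incr_order eqxx mulrC.
  by congr (_ * _); apply: eq_bigr => j ji; rewrite (negbTE ji).
by have h := is_derive_mode_deriv (lo i) (hi i) (k i) (o i) (x 0 i); exact: is_deriveZ.
Qed.

Lemma partial_deriv_box_mode_deriv k o i :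
  partial_deriv i (box_mode_deriv k o) = box_mode_deriv k (incr_order o i).
Proof. by apply/funext => x; case: (is_derive_box_mode_deriv k o i x). Qed.

Lemma continuous_box_mode_deriv k o : continuous (box_mode_deriv k o).
Proof.
apply: (@continuous_fun_prod _ _ _ _ _ (fun i (x : 'rV[R]_n) =>
  mode_deriv (lo i) (hi i) (k i) (o i) (x 0 i))) => i x.
apply: continuous_comp; first exact: coord_continuous.
exact: is_derive_continuous (is_derive_mode_deriv _ _ _ _) _.
Qed.

Lemma box_mode_deriv0 k : box_mode B bc k = box_mode_deriv k (fun=> 0%N).
Proof. by []. Qed.

Lemma box_mode_deriv_eq0 k o i x :
  mode_deriv (lo i) (hi i) (k i) (o i) (x 0 i) = 0 -> box_mode_deriv k o x = 0.
Proof. by move=> h; rewrite /box_mode_deriv (bigD1 i)//= h mul0r. Qed.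

Lemma C2_closure_box_mode k : C2_closure (box_set B) (box_mode B bc k).
Proof.
rewrite box_mode_deriv0; split.
- exact/continuous_subspaceT/continuous_box_mode_deriv.
- by move=> i x _; case: (is_derive_box_mode_deriv k (fun=> 0%N) i x).
- move=> i; rewrite partial_deriv_box_mode_deriv.
  exists (box_mode_deriv k (incr_order (fun=> 0%N) i)); split => //.
  exact/continuous_subspaceT/continuous_box_mode_deriv.
- move=> i j x _; rewrite partial_deriv_box_mode_deriv.
  by case: (is_derive_box_mode_deriv k (incr_order (fun=> 0%N) i) j x).
- move=> i j; rewrite !partial_deriv_box_mode_deriv.
  exists (box_mode_deriv k (incr_order (incr_order (fun=> 0%N) i) j)); split => //.
  exact/continuous_subspaceT/continuous_box_mode_deriv.
Qed.

Lemma laplace_box_mode k x : laplace (box_mode B bc k) x =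
  (\sum_(i < n) eigen1 bc (lo i) (hi i) (k i)) * box_mode B bc k x.
Proof.
rewrite /laplace -sumrN mulr_suml; apply: eq_bigr => i _.
rewrite box_mode_deriv0 !partial_deriv_box_mode_deriv /box_mode_deriv.
rewrite (bigD1 i)//= [in RHS](bigD1 i)//= /incr_order !eqxx/=.
rewrite [X in - (_ * X)](_ : _ = \prod_(j < n | j != i)
    mode_deriv (lo j) (hi j) (k j) 0 (x 0 j)); first by rewrite !mulNr opprK mulrA.
by apply: eq_bigr => j ji; rewrite (negbTE ji).
Qed.

Lemma satisfies_bc_box_mode k : satisfies_bc bc B (box_mode B bc k).
Proof.
have at_end i x : x 0 i = lo i \/ x 0 i = hi i ->
    bc_at bc (mode bc (lo i) (hi i) (k i) (x 0 i)) (dmode bc (lo i) (hi i) (k i) (x 0 i)).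
  by case=> ->; [exact: mode_bc_lo|apply: mode_bc_hi; exact: box_lo_lt_hi].
case E : bc => [|] /=.
  move=> x [clx nBx]; have /existsNP[i xi] := nBx; have := closure_closed_box clx i.
  move: xi; rewrite !in_itv/= => /negP; rewrite negb_and -!leNgt => h1 /andP[h2 h3].
  have /at_end : x 0 i = lo i \/ x 0 i = hi i.
    by case/orP: h1 => h1; [left|right]; apply/le_anti/andP.
  rewrite E /= => h0; rewrite -E box_mode_deriv0; apply: (@box_mode_deriv_eq0 _ _ i).
  by rewrite /= E.
move=> x v [i [xv _]]; rewrite -E;
  have xe : x 0 i = lo i \/ x 0 i = hi i by case: xv => -[-> _]; [right|left].
have P0 : box_mode_deriv k (incr_order (fun=> 0%N) i) x = 0.
  apply: (@box_mode_deriv_eq0 _ _ i); rewrite /incr_order eqxx/=.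
  by have := at_end i x xe; rewrite E.
have cP : box_mode_deriv k (incr_order (fun=> 0%N) i) y
    @[y --> within (box_set B) (nbhs x)] --> (0 : R).
  rewrite -P0; apply: cvg_trans (@continuous_box_mode_deriv k _ x).
  by apply: cvg_app; exact: cvg_within.
have FF : Filter (within (box_set B) (nbhs x)) by exact: within_filter.
case: xv => -[_ ->].
  apply: cvg_trans cP; apply: near_eq_cvg; apply: nearW => y.
  by rewrite -partial_deriv_box_mode_deriv.
have cN : - box_mode_deriv k (incr_order (fun=> 0%N) i) y
    @[y --> within (box_set B) (nbhs x)] --> (0 : R).
  by rewrite -oppr0; exact: cvgN.
apply: cvg_trans cN; apply: near_eq_cvg; apply: nearW => y.
rewrite derive_opp_basis_vec; first by rewrite box_mode_deriv0 partial_deriv_box_mode_deriv.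
by case: (is_derive_box_mode_deriv k (fun=> 0%N) i y).
Qed.

Lemma eigenspace_box_mode k l :
  \sum_(i < n) eigen1 bc (lo i) (hi i) (k i) = l ->
  Defs.eigenspace bc B l (box_mode B bc k).
Proof.
move=> <-; split; first exact: C2_closure_box_mode.
  by move=> x _; exact: laplace_box_mode.
exact: satisfies_bc_box_mode.
Qed.

End BoxModesAreEigenfunctions.

(** * Multiplicities *)

Section Multiplicity.
Variables (R : realType) (n : nat) (B : euclidean_box R n)
  (bc : boundary_condition).
Implicit Types (x y : 'rV[R]_n) (i j : 'I_n).
Notation lo i := (box_lo B 0 i).
Notation hi i := (box_hi B 0 i).

Lemma iter_coef_local m s f x y : (forall i, i \notin s -> x 0 i = y 0 i) ->
  iter_coef B bc m s f x = iter_coef B bc m s f y.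
Proof.
elim: s x y => [|i s IH] x y xy.
  by have -> : x = y by apply/rowP => i; exact: xy.
rewrite !iter_coef_cons /partial_coef; congr integ; apply/funext => t.
congr (_ * _); apply: IH => j js; rewrite !updE; case: eqP => // /eqP ji.
by apply: xy; rewrite inE negb_or ji.
Qed.

Lemma coef_cst m f x y : coef B bc m f x = coef B bc m f y.
Proof. by apply: iter_coef_local => i; rewrite mem_enum. Qed.

(** The multiset of these numbers is that of the side lengths in disguise. *)
Definition box_fundamentals : seq R :=
  [seq fundamental (lo i) (hi i) | i <- enum 'I_n].

Lemma box_fundamentals_gt0 : positive_seq box_fundamentals.
Proof. by apply/allP => _ /mapP[i _ ->]; rewrite fundamental_gt0// box_lo_lt_hi. Qed.

Lemma size_box_fundamentals : size box_fundamentals = n.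
Proof. by rewrite size_map size_enum_ord. Qed.

Lemma spectral_value_box (k : 'I_n -> nat) :
  spectral_value (bc_shift bc) box_fundamentals [seq k i | i <- enum 'I_n] =
  \sum_(i < n) eigen1 bc (lo i) (hi i) (k i).
Proof.
rewrite -big_enum /box_fundamentals /=; elim: (enum 'I_n) => [|i s IH] /=.
  by rewrite big_nil.
by rewrite big_cons IH.
Qed.

(** The basis consists of the box modes whose eigenvalue is [l].  They are
    independent because [coef m] vanishes on all of them but the one with mode
    numbers [m].  They span because an eigenfunction minus its components along
    them has only zero coefficients. *)
Lemma has_multiplicity_mode_count l :
  has_multiplicity bc B l (mode_count (bc_shift bc) box_fundamentals l).
Proof.
set M := modes (bc_shift bc) box_fundamentals l.
pose km (m : seq nat) : 'I_n -> nat := fun i => nth 0%N m i.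
have kmK m : size m = n -> [seq km m i | i <- enum 'I_n] = m.
  move=> sm; apply: (@eq_from_nth _ 0%N); first by rewrite size_map size_enum_ord.
  move=> p; rewrite size_map size_enum_ord => pn.
  by rewrite (nth_map (Ordinal pn)) ?size_enum_ord// /km nth_enum_ord.
have memM m : (m \in M) = (size m == n) &&
    (spectral_value (bc_shift bc) box_fundamentals m == l).
  by rewrite mem_modes ?box_fundamentals_gt0// size_map size_enum_ord.
pose k (a : 'I_(size M)) := km (nth [::] M a).
have kM (a : 'I_(size M)) : size (nth [::] M a) = n /\
    \sum_(i < n) eigen1 bc (lo i) (hi i) (k a i) = l.
  have : nth [::] M a \in M by exact: mem_nth.
  rewrite memM => /andP[/eqP sm /eqP vm]; split => //.
  by rewrite -spectral_value_box kmK.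
have k_neq (a a' : 'I_(size M)) : a != a' -> exists i, k a i != k a' i.
  move=> aa'; apply/existsP; apply: contraT; rewrite negb_exists => /forallP keq.
  move: aa'; apply: contraNT => _; apply/eqP/val_inj/eqP => /=.
  rewrite -(nth_uniq [::] (ltn_ord a) (ltn_ord a') (modes_uniq _ _ _)).
  rewrite -(kmK _ (kM a).1) -(kmK _ (kM a').1); apply/eqP.
  by apply: eq_map => i; apply/eqP; have := keq i; rewrite negbK.
pose b (a : 'I_(size M)) := box_mode B bc (k a).
have cb a : continuous (b a) by exact: continuous_box_mode.
have Bc := box_center_in B; set x0 := box_center B in Bc.
have coef_sum (m : 'I_n -> nat) (c : 'I_(size M) -> R) x :
    coef B bc m (fun y => \sum_(a < size M) c a * b a y) x =
    \sum_(a < size M) c a * coef B bc m (b a) x.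
  rewrite /coef iter_coef_sum; last first.
    by move=> a; apply: continuous_fun_mul; [exact: cst_continuous|exact: cb].
  by apply: eq_bigr => a _; rewrite iter_coefZ.
have coef_sum_at c (a : 'I_(size M)) x :
    \sum_(a' < size M) c a' * coef B bc (k a) (b a') x = c a * coef B bc (k a) (b a) x.
  rewrite (bigD1 a)//= big1 ?addr0// => a' /k_neq[i ki].
  by rewrite (@coef_box_mode_neq R n B bc _ _ _ i ki) mulr0.
exists b; split.
- by move=> a; apply: eigenspace_box_mode; exact: (kM a).2.
- move=> c c0 a.
  have : coef B bc (k a) (fun y => \sum_(a < size M) c a * b a y) x0 = 0.
    apply: etrans (iter_coef0 B bc (k a) (enum 'I_n) x0).
    by apply: eq_iter_coef => // y By; exact: c0.
  rewrite coef_sum coef_sum_at => /eqP; rewrite mulf_eq0 => /orP[/eqP//|].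
  by rewrite (negbTE (coef_box_mode_neq0 _ _ _ _)).
- move=> u eu; have [[cu _ _ _ _] _ _] := eu.
  have cu' : continuous (u \o clamp B) by exact: continuous_clamped.
  pose c (a : 'I_(size M)) := coef B bc (k a) (u \o clamp B) x0 / coef B bc (k a) (b a) x0.
  exists c => x Bx.
  pose S y := \sum_(a < size M) c a * b a y.
  have cS : continuous S.
    apply: (@continuous_fun_sum _ _ _ _ _ (fun a y => c a * b a y)) => a.
    by apply: continuous_fun_mul; [exact: cst_continuous|exact: cb].
  have cNS : continuous (fun y => -1 * S y).
    by apply: continuous_fun_mul; [exact: cst_continuous|exact: cS].
  have cv : continuous (fun y => (u \o clamp B) y + -1 * S y).
    exact: continuous_fun_add.
  have := @coef_complete R n B bc _ cv _ x Bx.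
  rewrite /= clamp_id; last exact: box_set_closed_box.
  rewrite mulN1r => H; apply/eqP; rewrite -subr_eq0; apply/eqP; apply: H => m y By.
  rewrite /coef iter_coefD// iter_coefZ// -!/(coef B bc m _) coef_sum.
  rewrite (coef_cst m _ y x0).
  under eq_bigr do rewrite (coef_cst m _ y x0).
  (* if [m] has the eigenvalue [l], its component was subtracted; otherwise it is 0 *)
  have [mM|mM] := boolP ([seq m i | i <- enum 'I_n] \in M).
    have im : (index [seq m i | i <- enum 'I_n] M < size M)%N by rewrite index_mem.
    have mk : m = k (Ordinal im).
      apply/funext => i; rewrite /k /km /= nth_index//.
      by rewrite (nth_map i) ?size_enum_ord// nth_ord_enum.
    rewrite mk coef_sum_at /c divfK ?mulN1r ?subrr//.
    exact: coef_box_mode_neq0.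
  have cu0 : coef B bc m (u \o clamp B) x0 = 0.
    have := coef_eigenfunction m eu Bc => /eqP.
    rewrite -subr_eq0 -mulrBl mulf_eq0 subr_eq0 => /orP[|/eqP//].
    rewrite -spectral_value_box => h; move: mM.
    by rewrite memM size_map size_enum_ord eqxx h.
  rewrite cu0 add0r big1 ?mulr0// => a _.
  have [ne|] := boolP [exists i, k a i != m i].
    by have /existsP[i ki] := ne; rewrite (@coef_box_mode_neq R n B bc _ _ _ i ki) mulr0.
  rewrite negb_exists => /forallP eqk; exfalso; move/negP: mM; apply.
  have -> : m = k a by apply/funext => i; apply/esym/eqP; have := eqk i; rewrite negbK.
  by rewrite kmK ?(kM a).1// mem_nth.
Qed.

End Multiplicity.

Section MultiplicityUnique.
Variables (R : realType) (n : nat) (B : euclidean_box R n)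
  (bc : boundary_condition).

(** Otherwise the coordinates of the first basis in the second one form a matrix
    with more rows than columns, and a vector of its kernel is a linear relation
    in the first basis. *)
Lemma has_multiplicity_le l p q :
  has_multiplicity bc B l p -> has_multiplicity bc B l q -> (p <= q)%N.
Proof.
move=> [b [be bi _]] [b' [_ _ bs]].
have [A HA] := choice (fun i => bs (b i) (be i)).
rewrite leqNgt; apply/negP => qp.
pose M : 'M[R]_(p, q) := \matrix_(i, j) A i j.
have : kermx M != 0.
  rewrite -mxrank_eq0 mxrank_ker subn_eq0 -ltnNge.
  exact: leq_ltn_trans (rank_leq_col _) qp.
move=> /rowV0Pn[v /sub_kermxP vM] /negP; apply; apply/eqP/rowP => i; rewrite mxE.
apply: (bi (fun i => v 0 i)) => x Bx.
under eq_bigr => j _ do rewrite HA// mulr_sumr.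
rewrite exchange_big big1//= => j _.
under eq_bigr => a _ do rewrite mulrA.
rewrite -mulr_suml; have /rowP/(_ j) := vM; rewrite !mxE.
by under eq_bigr => a _ do rewrite mxE; move=> ->; rewrite mul0r.
Qed.

Lemma has_multiplicity_uniq l p q :
  has_multiplicity bc B l p -> has_multiplicity bc B l q -> p = q.
Proof.
by move=> hp hq; apply/eqP; rewrite eqn_leq; apply/andP; split;
  exact: has_multiplicity_le hp hq || exact: has_multiplicity_le hq hp.
Qed.

End MultiplicityUnique.

(** * Isometry of boxes with the same sides *)

Section Isometry.
Variable R : realType.

Lemma fundamental_inj (a b c d : R) : 0 < b - a -> 0 < d - c ->
  fundamental a b = fundamental c d -> b - a = d - c.
Proof.
move=> ab cd /eqP; rewrite /fundamental eqrXn2 ?divr_ge0 ?pi_ge0 ?ltW// => /eqP.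
by move=> /(mulfI (lt0r_neq0 (pi_gt0 R))) /invr_inj.
Qed.

(** Permute the coordinates and translate the corners onto each other. *)
Lemma perm_fundamentals_isometric n1 n2 (B1 : euclidean_box R n1)
    (B2 : euclidean_box R n2) :
  perm_eq (box_fundamentals B1) (box_fundamentals B2) -> isometric B1 B2.
Proof.
move=> pe; have := perm_size pe.
rewrite !size_box_fundamentals => n12; subst n2.
pose len (B : euclidean_box R n1) (i : 'I_n1) := box_hi B 0 i - box_lo B 0 i.
have len_gt0 B i : 0 < len B i by rewrite subr_gt0 box_lo_lt_hi.
have [s Hs] : exists s : {perm 'I_n1}, forall i, len B2 i = len B1 (s i).
  pose T (B : euclidean_box R n1) := [tuple fundamental (box_lo B 0 i) (box_hi B 0 i) | i < n1].
  have : perm_eq (T B2) (T B1) by rewrite perm_sym.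
  move=> /tuple_permP[s /val_inj E]; exists s => i.
  have := congr1 (fun t => tnth t i) E; rewrite !tnth_mktuple.
  apply: fundamental_inj; exact: len_gt0.
pose f (x : 'rV[R]_n1) : 'rV[R]_n1 :=
  \row_j (box_lo B2 0 j + (x 0 (s j) - box_lo B1 0 (s j))).
exists f; split.
  move=> x y _ _; rewrite /euclidean_dist; congr Num.sqrt.
  rewrite [RHS](reindex_inj (@perm_inj _ s)) /=; apply: eq_bigr => i _.
  by rewrite !mxE; congr (_ ^+ 2); ring.
rewrite eqEsubset; split.
  move=> _ [x Bx <-] j; have := Bx (s j); have := Hs j.
  by rewrite /len !in_itv/= mxE => h /andP[h1 h2]; apply/andP; split; lra.
move=> y By; exists (\row_j (box_lo B1 0 j + (y 0 ((s^-1)%g j) - box_lo B2 0 ((s^-1)%g j)))).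
  move=> j; have := By ((s^-1)%g j); have := Hs ((s^-1)%g j).
  by rewrite /len permKV !in_itv/= mxE => h /andP[h1 h2]; apply/andP; split; lra.
by apply/rowP => j; rewrite !mxE permK; ring.
Qed.

End Isometry.

Theorem theorem2p36 (R : realType) (n1 n2 : nat)
    (n1_gt0 : (0 < n1)%N) (n2_gt0 : (0 < n2)%N)
    (B1 : euclidean_box R n1) (B2 : euclidean_box R n2) :
  isospectral Dirichlet B1 B2 \/ isospectral Neumann B1 B2 ->
  isometric B1 B2.
Proof.
suff main bc : isospectral bc B1 B2 -> isometric B1 B2 by case; exact: main.
move=> iso; apply: perm_fundamentals_isometric.
apply: (@mode_count_inj R (bc_shift bc)); [exact: box_fundamentals_gt0..|].
move=> l; apply: (@has_multiplicity_uniq R n2 B2 bc l).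
  exact/iso/has_multiplicity_mode_count.
exact: has_multiplicity_mode_count.
Qed.
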